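(* Let $0<\nu<1$. There exists a constant $c_\nu>0$, depending only on $\nu$, such that the following holds for every model $(\mathcal X,\mathcal V,\mathsf K,\Pi)$, every prior $\mu$ on $\Pi$ and every $\pi_\star\in\Pi$ as described in the context. Assume that $\mathsf K(x,v,w)\geqslant \nu$ for all $x\in\mathcal X$ and all $v,w\in\mathcal V$. Assume that $c_1,c_2>0$ are constants with $c_2>c_\nu+c_1$, and that there exist subsets $(\Pi_n)_{n\geqslant 1}$ of $\Pi$ and positive sequences $(\varepsilon_n)_{n\geqslant1}$, $(\tilde\varepsilon_n)_{n\geqslant 1}$ such that $(n\tilde\varepsilon_n^2)^{-1}\log^2(\tilde\varepsilon_n)=o(1)$ and, for all $n\geqslant 1$, $\tilde\varepsilon_n\leqslant\varepsilon_n$, $$\log \mathsf N(\Pi_n,\|\cdot\|_{\mathsf{tv}},\varepsilon_n)\leqslant n\varepsilon_n^2,\qquad \mu\big(\{\pi\in\Pi:\|\pi-\pi_\star\|_{\mathsf{tv}}\leqslant\tilde\varepsilon_n\}\big)\geqslant \mathrm e^{-c_1n\tilde\varepsilon_n^2},\qquad \mu(\Pi_n^c)\leqslant \mathrm e^{-c_2n\tilde\varepsilon_n^2}.$$ Then, for any positive sequence $(\alpha_n)_{n\geqslant1}$ such that $\alpha_n^{-1}=O(\mathrm e^{c_\alpha n\tilde\varepsilon_n^2})$ with $0<c_\alpha<c_2-c_\nu-c_1$, and for any $\bar c>2(1+\sqrt2)(1+\sqrt{c_2})\,c_\nu$, $$\mathbb P_{\pi_\star}\Big(\mu\big(\{\pi\in\Pi: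 R_{\pi_\star}(\pi)>\bar c\,\varepsilon_n\}\,\big|\,X_{1:n}\big)>\alpha_n\Big)\longrightarrow 0\quad\text{as } n\to\infty .$$
   Context: Model. $\mathcal X$ is a discrete set, $(\mathcal V,B(\mathcal V))$ is a measurable space, and $\mathsf K:\mathcal X\times\mathcal V\times\mathcal V\to[0,1]$ is a known measurable function such that $x\mapsto \mathsf K(x,v,w)$ is a probability mass function on $\mathcal X$ for all $v,w\in\mathcal V$. $\Pi$ is a set of probability measures on $(\mathcal V,B(\mathcal V))$. For $\pi\in\Pi$, $\mathbb P_\pi$ (expectation $\mathbb E_\pi$) is the law of the stationary process $(X_i,V_{i+1})_{i\in\mathbb Z}$ for which $(V_i)_{i\in\mathbb Z}$ are i.i.d. with law $\pi$ and, conditionally on $(V_i)_{i\in\mathbb Z}$, the $X_i$ are independent with $\mathbb P_\pi(X_i=x\mid V)=\mathsf K(x,V_i,V_{i+1})$. Write $a_{u:v}=(a_u,\dots,a_v)$. Log-likelihood: $\ell_n(\pi,x_{1:n})=\log\int\prod_{i=1}^n\mathsf K(x_i,v_i,v_{i+1})\,\pi^{\otimes (n+1)}(\mathrm dv_{1:n+1})$. Prior and posterior: $\Pi$ is equipped with a $\sigma$-algebra $\mathcal A$ and a prior probability $\mu$ (the usual measurability needed for the integrals below is assumed). The posterior is, for $A\in\mathcal A$, $$\mu(A\mid X_{1:n})=\frac{\int \mathbf 1_A(\pi)\,\mathrm e^{\ell_n(\pi,X_{1:n})}\,\mu(\mathrm d\pi)}{\int \mathrm e^{\ell_n(\pi,X_{1:n})}\,\mu(\mathrm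 d\pi)}.$$ $\pi_\star\in\Pi$ is the true distribution. Risk: when $\mathsf K\geqslant\nu>0$, for all $\pi,\pi'\in\Pi$ the limit $\mathsf L_{\pi'}(\pi)=\lim_{n\to\infty}\frac1n\ell_n(\pi,X_{1:n})$ exists $\mathbb P_{\pi'}$-a.s. and in $\mathrm L^1(\mathbb P_{\pi'})$ and is a deterministic constant. The risk is $R_{\pi_\star}(\pi)=\mathsf L_{\pi_\star}(\pi_\star)-\mathsf L_{\pi_\star}(\pi)$. Total variation: $\|\pi_1-\pi_2\|_{\mathsf{tv}}=\sup_{A\in B(\mathcal V)}|\pi_1(A)-\pi_2(A)|$. $\mathsf N(\widetilde\Pi,\|\cdot\|_{\mathsf{tv}},\varepsilon)$ is the minimal number of $\|\cdot\|_{\mathsf{tv}}$-balls of radius $\varepsilon$ needed to cover $\widetilde\Pi$. *)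

(* Defs.v *)
From HB Require Import structures.
From mathcomp Require Import all_boot all_order all_algebra.
From mathcomp Require Import all_classical all_reals all_analysis.

Set Implicit Arguments.
Unset Strict Implicit.
Unset Printing Implicit Defensive.

Import Order.TTheory GRing.Theory Num.Theory.
Import numFieldNormedType.Exports.

Local Open Scope classical_set_scope.
Local Open Scope ring_scope.

Section product_power.
Context {d : measure_display} {V : measurableType d} {R : realType}.

Definition tuple_cons n (p : V * n.-tuple V) : n.+1.-tuple V :=
  [tuple of p.1 :: p.2].

Lemma measurable_tuple_cons n : measurable_fun setT (@tuple_cons n).
Proof. exact: measurable_cons measurable_fst measurable_snd. Qed.

HB.instance Definition _ n := isMeasurableFun.Build _ _ _ _ (@tuple_cons n)
  (@measurable_tuple_cons n).

(* pi^{(x) n} on n.-tuple V, whose sigma-algebra is the product one; each step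
   transports pi \x pi^{(x) n} along V * V^n ~ V^n.+1. *)
Fixpoint power_probability (pi : probability V R) (n : nat) :
    probability (n.-tuple V) R :=
  match n with
  | 0 => \d_([tuple] : 0.-tuple V)
  | m.+1 => distribution (pi \x power_probability pi m)%E (@tuple_cons m)
  end.

End product_power.

Section total_variation.
Context {d : measure_display} {V : measurableType d} {R : realType}.

Definition tv_dist (p q : probability V R) : R :=
  sup [set `|fine (p A) - fine (q A)| | A in measurable].

(* Closed balls, centred at arbitrary probability measures on V; the value is
   +oo when no finite cover exists. *)
Definition covering_number (S : set (probability V R)) (eps : R) : \bar R :=
  ereal_inf [set m%:R%:E | m in
    [set m : nat | exists c : 'I_m -> probability V R,
       forall p, S p -> exists i, tv_dist p (c i) <= eps]].

End total_variation.

Section model.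
Context {R : realType} {X : choiceType} {d : measure_display}
  {V : measurableType d}.

(* X carries the power-set sigma-algebra, so measurability of K is
   measurability of each section K x. *)
Record emission_kernel (K : X -> V -> V -> R) : Prop := {
  emission_range : forall x v w, 0 <= K x v w <= 1 ;
  emission_measurable : forall x,
    measurable_fun [set: V * V] (fun vw => K x vw.1 vw.2) ;
  emission_pmf : forall v w, (\esum_(x in [set: X]) (K x v w)%:E)%E = 1%E
}.

Section process.
Context {d' : measure_display} {Omega : measurableType d'}.

Definition sigma_process (Vs : int -> Omega -> V) : set (set Omega) :=
  <<s \bigcup_i preimage_set_system setT (Vs i) measurable >>.

(* (Xs, Vs) is a realization on (Omega, P) of the process with law P_pi.
   process_emission is the defining property of
   P(X_i = x_i for all i in s | V) = \prod_(i in s) K(x_i, V_i, V_(i+1)),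
   the conditional probability being given sigma(V_j, j in Z). *)
Record process_law (K : X -> V -> V -> R) (pi : probability V R)
    (P : probability Omega R) (Xs : int -> Omega -> X)
    (Vs : int -> Omega -> V) : Prop := {
  process_measurableX : forall i (B : set X), measurable (Xs i @^-1` B) ;
  process_measurableV : forall i, measurable_fun setT (Vs i) ;
  process_lawV : forall i B, measurable B -> P (Vs i @^-1` B) = pi B ;
  process_indepV : forall (s : seq int) (B : int -> set V), uniq s ->
    (forall i, measurable (B i)) ->
    P (\bigcap_(i in [set` s]) (Vs i @^-1` B i)) =
      (\prod_(i <- s) P (Vs i @^-1` B i))%E ;
  process_emission : forall (s : seq int) (x : int -> X) (E : set Omega),
    uniq s -> sigma_process Vs E ->
    P (E `&` \bigcap_(i in [set` s]) (Xs i @^-1` [set x i])) =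
      (\int[P]_(w in E)
         (\prod_(i <- s) K (x i) (Vs i w) (Vs (i + 1) w))%R%:E)%E
}.

End process.

Definition loglik (K : X -> V -> V -> R) (n : nat) (pi : probability V R)
    (x : n.-tuple X) : R :=
  ln (\int[power_probability pi n.+1]_v
        \prod_(i < n) K (tnth x i) (tnth v (widen_ord (leqnSn n) i))
                                   (tnth v (lift ord0 i))).

Definition observations {Omega : Type} (Xs : int -> Omega -> X) (n : nat)
    (w : Omega) : n.-tuple X :=
  [tuple Xs (i.+1)%:Z w | i < n].

(* The a.s. and L^1 limit of loglik / n, a constant; xget 0 is only reached if
   no such constant exists. *)
Definition limit_loglik {d' : measure_display} {Omega : measurableType d'}
    (K : X -> V -> V -> R) (P : probability Omega R) (Xs : int -> Omega -> X)
    (pi : probability V R) : R :=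
  let avg n w := n%:R^-1 * loglik K pi (observations Xs n w) in
  xget 0 [set l : R |
    {ae P, forall w, (avg n w) @[n --> \oo] --> l} /\
    (\int[P]_w (`|avg n w - l|)%:E)%E @[n --> \oo] --> 0%E].

(* pistar must be the law of the hidden variables of the process (P, Xs). *)
Definition risk {d' : measure_display} {Omega : measurableType d'}
    (K : X -> V -> V -> R) (P : probability Omega R) (Xs : int -> Omega -> X)
    (pistar pi : probability V R) : R :=
  limit_loglik K P Xs pistar - limit_loglik K P Xs pi.

(* The parameter set Pi, a set of probability measures on V with its own
   sigma-algebra, is a measurable type embedded in probability V R by law. *)
Definition posterior {d' : measure_display} {Pi : measurableType d'}
    (K : X -> V -> V -> R) (law : Pi -> probability V R)
    (mu : probability Pi R) (n : nat) (x : n.-tuple X) (A : set Pi) : R :=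
  (\int[mu]_p (\1_A p * expR (loglik K (law p) x))) /
  (\int[mu]_p expR (loglik K (law p) x)).

End model.

(* Main.v *)
(* The middle factor [K b] of a word [u ++ b :: s] lies in [[nu, 1]], so the
   log-likelihood of the word is additive up to [ln nu^-1]; moreover, under the
   true law, letters two steps apart are independent.  Hence the log-likelihood
   has bounded Doob increments, which gives Azuma-type concentration, the
   existence of its limit per letter, and an error [O(1)] in the mean.

   The conditional law of the next letter is a Lipschitz function of the hidden
   law in total variation, uniformly in the past, because the backward recursion
   forgets its past at rate [1 - nu].  Consequently the log-likelihood is
   Lipschitz, and the chi-square divergence between the laws of [n] letters is at
   most [exp (C n tv^2) - 1].

   The chi-square bound controls the evidence from below (Jensen for [1 / x] and
   Markov); outside the sieve, Markov's inequality suffices; on the sieve, the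
   concentration bound is applied to each centre of the cover and transferred to
   the ball by the Lipschitz property.  The sieve estimate is exponential in
   [n eps_n] rather than [n eps_n^2]: it is only needed when [c_bar * eps_n] is
   below the maximal risk, in which case [c2 * epst_n^2 <= sqrt c2 * eps_n]. *)

From HB Require Import structures.
Require Import Defs.
From mathcomp Require Import all_boot all_order all_algebra.
From mathcomp Require Import ring lra.
From mathcomp Require Import all_classical all_reals all_analysis.
From mathcomp Require Import measurable_realfun.

Set Implicit Arguments.
Unset Strict Implicit.
Unset Printing Implicit Defensive.

Import Order.TTheory GRing.Theory Num.Theory.
Import numFieldNormedType.Exports.

Local Open Scope classical_set_scope.
Local Open Scope ring_scope.

(** * Integration of bounded functions and total variation *)

(** Time runs from right to left: a suffix [s] is known and the next letter is prepended to it, so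
    the past of a letter is what stands on its right. This matches the recursion that integrates out
    the hidden variables.

    A letter of mass at least [nu] for every pair of hidden states leaves at most [1 / nu] letters.
    The alphabet is therefore finite, every event about [n] observations has a probability that is a
    finite sum of [lik] over words, and conditional expectations become quotients of such sums.

    The obstacle is that the observed sequence is not Markov: the law of a letter depends on all the
    past, and comparing two hidden laws letter by letter could accumulate errors. The comparison is
    therefore projective: two backward functions are compared up to an unknown scale, which is
    contracted at each step and cancels in the predictive ratio.

    The chi-square divergence is used because it is quadratic in total variation, so a ball of
    radius [epst n] costs an exponent of order [n * epst n ^+ 2], the scale of its prior mass. *)

Definition bounded_measurable {d : measure_display} {T : measurableType d}
    {R : realType} (f : T -> R) :=
  measurable_fun setT f /\ exists M, forall x, `|f x| <= M.

Section bounded_measurable.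
Context {d : measure_display} {T : measurableType d} {R : realType}.
Implicit Types (f g : T -> R) (c : R).

Lemma bounded_measurable_cst c : bounded_measurable (fun _ : T => c).
Proof. by split; [exact: measurable_cst | exists `|c|]. Qed.

Lemma bounded_measurableD f g : bounded_measurable f -> bounded_measurable g ->
  bounded_measurable (fun x => f x + g x).
Proof.
move=> [mf [M hM]] [mg [N hN]]; split; first exact: measurable_funD.
by exists (M + N) => x; rewrite (le_trans (ler_normD _ _))// lerD.
Qed.

Lemma bounded_measurableM f g : bounded_measurable f -> bounded_measurable g ->
  bounded_measurable (fun x => f x * g x).
Proof.
move=> [mf [M hM]] [mg [N hN]]; split; first exact: measurable_funM.
by exists (M * N) => x; rewrite normrM ler_pM.
Qed.

Lemma bounded_measurableB f g : bounded_measurable f -> bounded_measurable g ->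
  bounded_measurable (fun x => f x - g x).
Proof.
move=> [mf [M hM]] [mg [N hN]]; split; first exact: measurable_funB.
by exists (M + N) => x; rewrite (le_trans (ler_normB _ _))// lerD.
Qed.

Lemma bounded_measurable_sum (I : eqType) (r : seq I) (f : I -> T -> R) :
  (forall i, i \in r -> bounded_measurable (f i)) ->
  bounded_measurable (fun x => \sum_(i <- r) f i x).
Proof.
elim: r => [|i r ih] h.
  under eq_fun do rewrite big_nil; exact: bounded_measurable_cst.
under eq_fun do rewrite big_cons; apply: bounded_measurableD.
  by apply: h; rewrite mem_head.
by apply: ih => j jr; apply: h; rewrite inE jr orbT.
Qed.

Lemma bounded_measurable_indic (A : set T) : measurable A ->
  bounded_measurable (\1_A : T -> R).
Proof.
move=> mA; split; first exact: measurable_indic.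
by exists 1 => x; rewrite indicE; case: (x \in A) => /=; rewrite ?normr1 ?normr0.
Qed.

Lemma itv_bounded_measurable f a b : measurable_fun setT f ->
  (forall x, a <= f x <= b) -> bounded_measurable f.
Proof.
move=> mf h; split => //; exists (`|a| + `|b|) => x.
have /andP[h1 h2] := h x; rewrite ler_norml; apply/andP; split.
- by have := ler_norm (- a); rewrite normrN; have := normr_ge0 b; lra.
- by have := ler_norm b; have := normr_ge0 a; lra.
Qed.

Variable mu : probability T R.

Lemma bounded_measurable_integrable f : bounded_measurable f ->
  mu.-integrable setT (EFin \o f).
Proof.
move=> [mf [M hM]]; apply: measurable_bounded_integrable => //.
- exact: le_lt_trans (probability_le1 mu measurableT) (ltry 1).
- exists M; split => [|y yM x _]; first exact: num_real.
  exact: le_trans (hM x) (ltW yM).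
Qed.

Lemma EFin_Rintegral f : bounded_measurable f ->
  (\int[mu]_x (f x)%:E)%E = (\int[mu]_x f x)%:E.
Proof.
move=> bf; rewrite /Rintegral fineK//; apply: integrable_fin_num => //.
exact: bounded_measurable_integrable.
Qed.

Lemma prob_Rintegral_cst c : \int[mu]_x c = c.
Proof.
transitivity (c * fine (mu setT)); first exact: Rintegral_cst.
by rewrite probability_setT mulr1.
Qed.

Lemma prob_RintegralD f g : bounded_measurable f -> bounded_measurable g ->
  \int[mu]_x (f x + g x) = \int[mu]_x f x + \int[mu]_x g x.
Proof.
by move=> bf bg; rewrite RintegralD//; exact: bounded_measurable_integrable.
Qed.

Lemma prob_RintegralB f g : bounded_measurable f -> bounded_measurable g ->
  \int[mu]_x (f x - g x) = \int[mu]_x f x - \int[mu]_x g x.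
Proof.
by move=> bf bg; rewrite RintegralB//; exact: bounded_measurable_integrable.
Qed.

Lemma prob_RintegralZl c f : bounded_measurable f ->
  \int[mu]_x (c * f x) = c * \int[mu]_x f x.
Proof.
by move=> bf; rewrite RintegralZl//; exact: bounded_measurable_integrable.
Qed.

Lemma prob_Rintegral_sum (I : eqType) (r : seq I) (f : I -> T -> R) :
  (forall i, i \in r -> bounded_measurable (f i)) ->
  \int[mu]_x (\sum_(i <- r) f i x) = \sum_(i <- r) \int[mu]_x f i x.
Proof.
elim: r => [|i r ih] h.
  by under eq_Rintegral do rewrite big_nil; rewrite big_nil prob_Rintegral_cst.
under eq_Rintegral do rewrite big_cons.
have h' j : j \in r -> bounded_measurable (f j).
  by move=> jr; apply: h; rewrite inE jr orbT.
rewrite prob_RintegralD ?ih ?big_cons//; first by apply: h; rewrite mem_head.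
exact: bounded_measurable_sum.
Qed.

Lemma prob_le_Rintegral f g : bounded_measurable f -> bounded_measurable g ->
  (forall x, f x <= g x) -> \int[mu]_x f x <= \int[mu]_x g x.
Proof.
by move=> bf bg h; apply: le_Rintegral => //; exact: bounded_measurable_integrable.
Qed.

Lemma prob_Rintegral_indic (A : set T) : measurable A ->
  \int[mu]_x (\1_A x : R) = fine (mu A).
Proof. by move=> mA; rewrite /Rintegral integral_indic// setIT. Qed.

End bounded_measurable.

Section total_variation.
Context {d : measure_display} {V : measurableType d} {R : realType}.
Implicit Types p q : probability V R.

Let tv_set p q := [set `|fine (p A) - fine (q A)| | A in measurable].

Lemma tv_set_ub1 p q : ubound (tv_set p q) 1.
Proof.
move=> _ [A mA <-].
have := probability_le1 p mA; have := probability_le1 q mA.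
have : (0 <= p A)%E by []; have : (0 <= q A)%E by [].
rewrite -[p A]fineK ?fin_num_measure// -[q A]fineK ?fin_num_measure//.
by rewrite !lee_fin ler_norml => *; apply/andP; split; lra.
Qed.

Lemma tv_dist_ub p q (A : set V) : measurable A ->
  `|fine (p A) - fine (q A)| <= tv_dist p q.
Proof.
move=> mA; apply: ub_le_sup; last by exists A.
by exists 1; exact: tv_set_ub1.
Qed.

Lemma tv_dist_ge0 p q : 0 <= tv_dist p q.
Proof. exact: le_trans (normr_ge0 _) (tv_dist_ub p q measurableT). Qed.

Lemma tv_dist_le1 p q : tv_dist p q <= 1.
Proof.
apply: ge_sup; last exact: tv_set_ub1.
by exists `|fine (p setT) - fine (q setT)|, setT.
Qed.

Lemma tv_distC p q : tv_dist p q = tv_dist q p.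
Proof.
congr sup; apply/seteqP; split => _ [A mA <-]; exists A => //;
  exact: distrC.
Qed.

(** The sum counts the positive integers up to [y], so it is the integer part of [y], in the
    layer-cake form that turns a function into a sum of indicators. *)
Lemma sum_level_bounds (n : nat) (y : R) : 0 <= y <= n%:R ->
  y - 1 <= \sum_(k < n) ((k.+1%:R : R) <= y)%R%:R <= y.
Proof.
elim: n y => [|n ih] y /andP[y0 yn].
  by rewrite big_ord0; apply/andP; split; lra.
rewrite big_ord_recr /=; have [yn'|yn'] := leP y n%:R.
  have -> : (n.+1%:R <= y) = false.
    by apply/negbTE; rewrite -ltNge -natr1; lra.
  by rewrite addr0; apply: ih; rewrite y0.
rewrite (eq_bigr (fun=> 1)) => [|k _]; last first.
  by rewrite (le_trans _ (ltW yn'))// ler_nat.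
rewrite sumr_const card_ord; have := yn; rewrite -natr1 => yn2.
by case: (leP (n%:R + 1) y) => /= h; apply/andP; split; lra.
Qed.

(** Up to an error [1 / (n + 1)], [f] is the average of the indicators of its level sets, and each
    indicator contributes at most one total variation distance. *)
Lemma tv_dist_Rintegral1 p q (f : V -> R) : measurable_fun setT f ->
  (forall v, 0 <= f v <= 1) ->
  `|\int[p]_v f v - \int[q]_v f v| <= tv_dist p q.
Proof.
move=> mf f01; suff key (e : R) : 0 < e ->
    `|\int[p]_v f v - \int[q]_v f v| <= tv_dist p q + e.
  by apply/ler_addgt0Pr => e; exact: key.
move=> e0.
have [n ne] : exists n : nat, 2 / n.+1%:R < e.
  exists (Num.truncn (2 / e)); rewrite ltr_pdivrMr ?ltr0n// mulrC.
  rewrite -ltr_pdivrMr//; exact: truncnS_gt.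
pose A (k : 'I_n.+1) := [set v | k.+1%:R <= n.+1%:R * f v].
have mA k : measurable (A k).
  have -> : A k = (fun v => n.+1%:R * f v) @^-1` `[k.+1%:R, +oo[.
    by apply/seteqP; split => v; rewrite /A /= in_itv /= andbT.
  rewrite -[X in measurable X]setTI.
  have mg : measurable_fun setT (fun v => n.+1%:R * f v).
    exact: measurable_funM.
  by apply: mg.
pose g v := n.+1%:R^-1 * \sum_(k < n.+1) (\1_(A k) v : R).
have bi k : bounded_measurable (\1_(A k) : V -> R).
  exact: bounded_measurable_indic.
have bs : bounded_measurable (fun v => \sum_(k < n.+1) (\1_(A k) v : R)).
  by apply: bounded_measurable_sum.
have bg : bounded_measurable g.
  by apply: bounded_measurableM => //; exact: bounded_measurable_cst.
have bf : bounded_measurable f by exact: (itv_bounded_measurable mf f01).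
have n0 : 0 < n.+1%:R :> R by rewrite ltr0n.
have gf v : f v - n.+1%:R^-1 <= g v <= f v.
  have [f0 f1] := andP (f01 v).
  have : 0 <= n.+1%:R * f v <= n.+1%:R.
    apply/andP; split; first exact: mulr_ge0 (ltW n0) f0.
    by rewrite ler_piMr// ltW.
  move=> /sum_level_bounds.
  have -> : \sum_(k < n.+1) ((k.+1%:R : R) <= n.+1%:R * f v)%R%:R =
      \sum_(k < n.+1) (\1_(A k) v : R).
    apply: eq_bigr => k _; rewrite indicE; congr (_ %:R); congr nat_of_bool.
    by apply/idP/idP => [h|]; rewrite ?inE //; exact: mem_set.
  move=> /andP[h1 h2]; rewrite /g; apply/andP; split.
    rewrite -(ler_pM2l n0) mulrA divff ?gt_eqF// mul1r mulrBr divff ?gt_eqF//.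
  by rewrite -(ler_pM2l n0) mulrA divff ?gt_eqF// mul1r.
have int_g (r : probability V R) :
    \int[r]_v g v = n.+1%:R^-1 * \sum_(k < n.+1) fine (r (A k)).
  rewrite prob_RintegralZl// prob_Rintegral_sum//; congr (_ * _).
  by apply: eq_bigr => k _; rewrite prob_Rintegral_indic.
have int_gf (r : probability V R) :
    \int[r]_v f v - n.+1%:R^-1 <= \int[r]_v g v <= \int[r]_v f v.
  apply/andP; split; last first.
    by apply: prob_le_Rintegral => // v; have /andP[] := gf v.
  rewrite -{1}(prob_Rintegral_cst r n.+1%:R^-1) -prob_RintegralB//; last first.
    exact: bounded_measurable_cst.
  apply: prob_le_Rintegral => //; last by move=> v; have /andP[] := gf v.
  by apply: bounded_measurableB => //; exact: bounded_measurable_cst.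
have tvg : `|\int[p]_v g v - \int[q]_v g v| <= tv_dist p q.
  rewrite !int_g -mulrBr -sumrB normrM gtr0_norm ?invr_gt0//.
  rewrite ler_pdivrMl//; apply: (le_trans (ler_norm_sum _ _ _)).
  apply: (@le_trans _ _ (\sum_(k < n.+1) tv_dist p q)).
    by apply: ler_sum => k _; exact: tv_dist_ub.
  by rewrite sumr_const card_ord mulr_natl.
have /andP[p1 p2] := int_gf p; have /andP[q1 q2] := int_gf q.
have nV : 0 < n.+1%:R^-1 :> R by rewrite invr_gt0.
have arith (If Ig Jf Jg c t : R) : If - c <= Ig -> Ig <= If -> Jf - c <= Jg ->
    Jg <= Jf -> 0 < c -> 2 * c < e -> - t <= Ig - Jg -> Ig - Jg <= t ->
    - (t + e) <= If - Jf <= t + e.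
  by move=> *; apply/andP; split; lra.
move: tvg; rewrite !ler_norml => /andP[t1 t2].
exact: arith p1 p2 q1 q2 nV ne t1 t2.
Qed.

Lemma tv_dist_Rintegral p q (f : V -> R) c : 0 < c -> measurable_fun setT f ->
  (forall v, 0 <= f v <= c) ->
  `|\int[p]_v f v - \int[q]_v f v| <= c * tv_dist p q.
Proof.
move=> c0 mf f0c.
have bf := itv_bounded_measurable mf f0c.
have h : measurable_fun setT (fun v => c^-1 * f v) by exact: measurable_funM.
have := @tv_dist_Rintegral1 p q _ h; rewrite !prob_RintegralZl// -mulrBr.
rewrite normrM gtr0_norm ?invr_gt0// ler_pdivrMl//; apply.
move=> v; have /andP[f0 fc] := f0c v; apply/andP; split.
  by rewrite mulr_ge0// invr_ge0 ltW.
by rewrite ler_pdivrMl// mulr1.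
Qed.

End total_variation.

(** * Likelihood and stability of the backward recursion *)

Section doeblin.
Context {d : measure_display} {V : measurableType d} {R : realType}.
Implicit Types (p q : probability V R) (f F G k : V -> R).

(* The lower bound on [k] extracts a common part [nu * \int F] from every
   [\int k F], which shrinks the spread of the ratio of the integrals by the
   factor [1 - nu], uniformly in [k]. *)
Lemma doeblin_contraction (nu : R) p F G (m h : R) : 0 < nu -> nu <= 1 ->
  0 < m -> 0 <= h -> bounded_measurable F -> bounded_measurable G ->
  0 < \int[p]_w G w ->
  (forall w, m * G w <= F w <= m * (1 + h) * G w) ->
  exists2 m' : R, 0 < m' & forall k, bounded_measurable k ->
    (forall w, nu <= k w <= 1) -> (forall w, 0 <= G w) ->
    m' * \int[p]_w (k w * G w) <= \int[p]_w (k w * F w)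
      <= m' * (1 + (1 - nu) * h) * \int[p]_w (k w * G w).
Proof.
move=> nu0 nu1 m0 h0 bF bG IG0 mFM; have nuW := ltW nu0.
set IG := \int[p]_w G w in IG0 *; set IF := \int[p]_w F w.
set M := m * (1 + h) in mFM *.
have mIF : m * IG <= IF.
  rewrite -prob_RintegralZl//; apply: prob_le_Rintegral => //.
    by apply: bounded_measurableM => //; exact: bounded_measurable_cst.
  by move=> w; have /andP[] := mFM w.
(* The ratio of the integrals of [F] and [G] is [m + q]. Weighting by [k] keeps the ratio between
   [m + nu * q] and [M - nu * (M - m - q)], an interval of length [(1 - nu) * m * h]; its lower end
   is the new scale. *)
pose q := IF / IG - m.
have q0 : 0 <= q by rewrite subr_ge0 ler_pdivlMr.
have IFE : IF = (m + q) * IG by rewrite /q addrC subrK divfK ?gt_eqF.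
exists (m + nu * q) => [|k bk k01 G0].
  by rewrite ltr_pwDl// mulr_ge0// ltW.
have bkG : bounded_measurable (fun w => k w * G w) by exact: bounded_measurableM.
have bkF : bounded_measurable (fun w => k w * F w) by exact: bounded_measurableM.
have bc (c : R) : bounded_measurable (fun _ : V => c) by exact: bounded_measurable_cst.
set kG := \int[p]_w (k w * G w); set kF := \int[p]_w (k w * F w).
have h1 : nu * (IF - m * IG) <= kF - m * kG.
  rewrite -!prob_RintegralZl// -!prob_RintegralB//;
    try by apply: bounded_measurableM.
  rewrite -prob_RintegralZl; last first.
    by apply: bounded_measurableB => //; exact: bounded_measurableM.
  apply: prob_le_Rintegral => [||w].
  - by apply: bounded_measurableM => //; apply: bounded_measurableB => //;
      exact: bounded_measurableM.
  - by apply: bounded_measurableB => //; exact: bounded_measurableM.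
  have /andP[a1 a2] := mFM w; have /andP[a3 a4] := k01 w.
  have : 0 <= (k w - nu) * (F w - m * G w) by rewrite mulr_ge0// subr_ge0.
  lra.
have h2 : nu * (M * IG - IF) <= M * kG - kF.
  rewrite -!prob_RintegralZl// -!prob_RintegralB//;
    try by apply: bounded_measurableM.
  rewrite -prob_RintegralZl; last first.
    by apply: bounded_measurableB => //; exact: bounded_measurableM.
  apply: prob_le_Rintegral => [||w].
  - by apply: bounded_measurableM => //; apply: bounded_measurableB => //;
      exact: bounded_measurableM.
  - by apply: bounded_measurableB => //; exact: bounded_measurableM.
  have /andP[a1 a2] := mFM w; have /andP[a3 a4] := k01 w.
  have : 0 <= (k w - nu) * (M * G w - F w) by rewrite mulr_ge0// subr_ge0.
  lra.
have h3 : kG <= IG.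
  apply: prob_le_Rintegral => // w; have /andP[a3 a4] := k01 w.
  by rewrite ler_piMl.
have qM : q <= M - m.
  have : IF <= M * IG.
    rewrite -prob_RintegralZl//; apply: prob_le_Rintegral => //.
      by apply: bounded_measurableM.
    by move=> w; have /andP[] := mFM w.
  by rewrite IFE ler_pM2r//; lra.
have kG0 : 0 <= kG.
  apply: Rintegral_ge0 => w _; have /andP[a3 a4] := k01 w.
  by rewrite mulr_ge0// (le_trans (ltW nu0)).
apply/andP; split.
  have : 0 <= nu * q * (IG - kG) by rewrite !mulr_ge0// subr_ge0.
  by move: h1; rewrite IFE; lra.
have e1 : 0 <= nu * (M - m - q) * (IG - kG).
  by rewrite !mulr_ge0// subr_ge0.
have e2 : 0 <= nu * q * ((1 - nu) * h) * kG.
  by rewrite !mulr_ge0// subr_ge0.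
have e3 : kF <= (M - nu * (M - m - q)) * kG by move: h2; rewrite IFE; lra.
apply: (le_trans e3); rewrite /M in e1 e2 *; lra.
Qed.

(** The lower bound [r * c] on the integrand turns the additive error [c * tv_dist p q] into a
    relative one, which composes with projective bounds. *)
Lemma tv_dist_ratio p q f (c r : R) : 0 < c -> 0 < r -> measurable_fun setT f ->
  (forall v, r * c <= f v <= c) ->
  \int[p]_v f v <= (1 + tv_dist p q / r) * \int[q]_v f v.
Proof.
move=> c0 r0 mf fc; have bf := itv_bounded_measurable mf fc.
have fc0 v : 0 <= f v <= c.
  by have /andP[f1 ->] := fc v; rewrite (le_trans _ f1)// mulr_ge0// ltW.
have := tv_dist_Rintegral p q c0 mf fc0; rewrite ler_norml => /andP[_ h].
have rc : r * c <= \int[q]_v f v.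
  rewrite -(prob_Rintegral_cst q (r * c)); apply: prob_le_Rintegral => //.
    exact: bounded_measurable_cst.
  by move=> v; have /andP[] := fc v.
have : c * tv_dist p q <= tv_dist p q / r * \int[q]_v f v.
  rewrite mulrC -mulrA ler_wpM2l ?tv_dist_ge0//.
  by rewrite ler_pdivlMl.
lra.
Qed.

End doeblin.

(** * Likelihood of a word by the backward recursion *)

Section likelihood.
Context {R : realType} {X : choiceType} {d : measure_display}
  {V : measurableType d}.
Variable K : X -> V -> V -> R.
Implicit Types (p q : probability V R) (s u : seq X).

(** The backward variable of the hidden chain: the probability of emitting [s] when its first hidden
    variable is [v]. *)
Fixpoint backward p s (v : V) : R :=
  if s is a :: s' then \int[p]_w (K a v w * backward p s' w) else 1.

Definition lik p s : R := \int[p]_v backward p s v.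

Variable nu : R.
Hypotheses (nu0 : 0 < nu) (nu1 : nu <= 1).
Hypothesis K_bounds : forall x v w, nu <= K x v w <= 1.
Hypothesis K_measurable : forall x,
  measurable_fun [set: V * V] (fun vw => K x vw.1 vw.2).

Lemma measurable_Rintegral_param p (h : V * V -> R) :
  measurable_fun setT h -> (forall z, 0 <= h z) ->
  measurable_fun setT (fun v => \int[p]_w h (v, w)).
Proof.
move=> mh h0.
have m1 : measurable_fun setT (fubini_F p (EFin \o h)).
  apply: measurable_fun_fubini_tonelli_F => //; first exact/measurable_EFinP.
exact: (measurableT_comp (fine_measurable measurableT) m1).
Qed.

Lemma bounded_measurable_section a v : bounded_measurable (K a v).
Proof.
apply: (@itv_bounded_measurable _ _ _ _ nu 1) => //.
have := measurableT_comp (K_measurable a)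
  (measurable_fun_pair (measurable_cst v) (@measurable_id _ V setT)).
exact.
Qed.

Lemma measurable_step p a (g : V -> R) : measurable_fun setT g ->
  (forall v, 0 <= g v) -> measurable_fun setT (fun v => \int[p]_w (K a v w * g w)).
Proof.
move=> mg g0.
apply: (@measurable_Rintegral_param p (fun z => K a z.1 z.2 * g z.2)).
  by apply: measurable_funM => //; exact: measurableT_comp.
move=> z; rewrite mulr_ge0//; have /andP[h _] := K_bounds a z.1 z.2.
exact: le_trans (ltW nu0) h.
Qed.

Lemma backward_01 p s :
  measurable_fun setT (backward p s) /\ (forall v, 0 <= backward p s v <= 1).
Proof.
elim: s => [|a s [ms s01]] /=.
  by split; [exact: measurable_cst|move=> v; rewrite ler01 lexx].
have s0 v : 0 <= backward p s v by have /andP[] := s01 v.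
split; first exact: measurable_step.
move=> v; apply/andP; split.
  apply: Rintegral_ge0 => w _; rewrite mulr_ge0//.
  by have /andP[h _] := K_bounds a v w; exact: le_trans (ltW nu0) h.
rewrite -(prob_Rintegral_cst p 1); apply: prob_le_Rintegral.
- apply: bounded_measurableM; first exact: bounded_measurable_section.
  exact: itv_bounded_measurable ms s01.
- exact: bounded_measurable_cst.
- move=> w; have /andP[h h'] := K_bounds a v w; have /andP[h2 h3] := s01 w.
  by rewrite mulr_ile1// (le_trans (ltW nu0) h).
Qed.

Lemma backward_ge0 p s v : 0 <= backward p s v.
Proof. by have [_ /(_ v) /andP[]] := backward_01 p s. Qed.

Lemma bounded_measurable_backward p s : bounded_measurable (backward p s).
Proof. by have [m h] := backward_01 p s; exact: itv_bounded_measurable m h. Qed.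

Lemma bounded_measurable_section_backward p a s v :
  bounded_measurable (fun w => K a v w * backward p s w).
Proof.
apply: bounded_measurableM; first exact: bounded_measurable_section.
exact: bounded_measurable_backward.
Qed.

Lemma backward_cons_bounds p a s v :
  nu * lik p s <= backward p (a :: s) v <= lik p s.
Proof.
have b := bounded_measurable_backward p s.
have bk := bounded_measurable_section_backward p a s v.
apply/andP; split => /=.
  rewrite -prob_RintegralZl//; apply: prob_le_Rintegral => //.
    by apply: bounded_measurableM => //; exact: bounded_measurable_cst.
  move=> w; rewrite ler_wpM2r ?backward_ge0//.
  by have /andP[] := K_bounds a v w.
apply: prob_le_Rintegral => // w; rewrite ler_piMl ?backward_ge0//.
by have /andP[] := K_bounds a v w.
Qed.

Lemma lik_nil p : lik p [::] = 1.
Proof. exact: prob_Rintegral_cst. Qed.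

Lemma lik_cons_bounds p a s : nu * lik p s <= lik p (a :: s) <= lik p s.
Proof.
have b := bounded_measurable_backward p (a :: s).
have bc (c : R) : bounded_measurable (fun _ : V => c) by exact: bounded_measurable_cst.
apply/andP; split.
  rewrite -(prob_Rintegral_cst p (nu * lik p s)); apply: prob_le_Rintegral => //.
  by move=> v; have /andP[] := backward_cons_bounds p a s v.
rewrite -[leRHS](prob_Rintegral_cst p); apply: prob_le_Rintegral => //.
by move=> v; have /andP[] := backward_cons_bounds p a s v.
Qed.

Lemma lik_gt0 p s : 0 < lik p s.
Proof.
elim: s => [|a s ih]; first by rewrite lik_nil.
by have /andP[h _] := lik_cons_bounds p a s; rewrite (lt_le_trans _ h)// mulr_gt0.
Qed.

Lemma lik_le1 p s : lik p s <= 1.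
Proof.
elim: s => [|a s ih]; first by rewrite lik_nil.
by have /andP[_ h] := lik_cons_bounds p a s; exact: le_trans h ih.
Qed.

Lemma backward_bounds p s :
  exists2 c : R, 0 < c & forall v, nu * c <= backward p s v <= c.
Proof.
case: s => [|a s].
  by exists 1 => // v /=; rewrite mulr1 nu1 lexx.
by exists (lik p s); [exact: lik_gt0 | exact: backward_cons_bounds].
Qed.

Lemma backward_cat_bounds p u b s v :
  nu * lik p s * backward p u v <= backward p (u ++ b :: s) v
    <= lik p s * backward p u v.
Proof.
elim: u v => [|a u ih] v.
  by rewrite cat0s [in X in _ * X]/= !mulr1; exact: backward_cons_bounds.
rewrite cat_cons /=.
have bc (c : R) : bounded_measurable (fun _ : V => c) by exact: bounded_measurable_cst.
have bu := bounded_measurable_section_backward p a u v.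
have bs := bounded_measurable_section_backward p a (u ++ b :: s) v.
have K0 w : 0 <= K a v w.
  by have /andP[h _] := K_bounds a v w; exact: le_trans (ltW nu0) h.
rewrite -(prob_RintegralZl p (nu * lik p s) bu) -(prob_RintegralZl p (lik p s) bu).
apply/andP; split; apply: prob_le_Rintegral => //; try exact: bounded_measurableM.
- by move=> w; rewrite mulrCA ler_wpM2l//; have /andP[] := ih w.
- by move=> w; rewrite [leRHS]mulrCA ler_wpM2l//; have /andP[] := ih w.
Qed.

Lemma lik_cat_bounds p u b s :
  nu * (lik p u * lik p s) <= lik p (u ++ b :: s) <= lik p u * lik p s.
Proof.
have bc (c : R) : bounded_measurable (fun _ : V => c) by exact: bounded_measurable_cst.
have bu := bounded_measurable_backward p u.
have bs := bounded_measurable_backward p (u ++ b :: s).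
rewrite [lik p u * _]mulrC mulrA.
rewrite -(prob_RintegralZl p (nu * lik p s) bu) -(prob_RintegralZl p (lik p s) bu).
apply/andP; split; apply: prob_le_Rintegral => //; try exact: bounded_measurableM.
- by move=> v; have /andP[] := backward_cat_bounds p u b s v.
- by move=> v; have /andP[] := backward_cat_bounds p u b s v.
Qed.

(** Summing over the middle letter replaces its kernel by 1, which was the only link between the
    hidden variables of [u] and those of [s]. *)
Lemma sum_backward_cat p (E : seq X) u s v :
  (forall v w, \sum_(b <- E) K b v w = 1) ->
  \sum_(b <- E) backward p (u ++ b :: s) v = lik p s * backward p u v.
Proof.
move=> sumK; elim: u v => [|a u ih] v /=.
  rewrite -prob_Rintegral_sum.
    rewrite mulr1; apply: eq_Rintegral => w _.
    by rewrite -mulr_suml sumK mul1r.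
  by move=> b _; exact: bounded_measurable_section_backward.
rewrite -prob_Rintegral_sum; last first.
  by move=> b _; exact: bounded_measurable_section_backward.
rewrite -prob_RintegralZl; last exact: bounded_measurable_section_backward.
by apply: eq_Rintegral => w _; rewrite -mulr_sumr ih mulrCA.
Qed.

Lemma sum_lik_cat p (E : seq X) u s :
  (forall v w, \sum_(b <- E) K b v w = 1) ->
  \sum_(b <- E) lik p (u ++ b :: s) = lik p u * lik p s.
Proof.
move=> sumK; rewrite -prob_Rintegral_sum; last first.
  by move=> b _; exact: bounded_measurable_backward.
rewrite mulrC -prob_RintegralZl; last exact: bounded_measurable_backward.
by apply: eq_Rintegral => v _; exact: sum_backward_cat.
Qed.

(** Contraction is applied under the single law [p]; the integral of the [q] function is then moved
    from [p] to [q]. The integrand lies between [nu ^+ 2 * c] and [c], whence the relative error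
    [tv_dist p q / nu ^+ 2]; it is paid once in each of the two bounds, which gives the square. *)
Lemma backward_step p q s (m h : R) a : 0 < m -> 0 <= h ->
  (forall v, m * backward q s v <= backward p s v
     <= m * (1 + h) * backward q s v) ->
  exists2 m' : R, 0 < m' & forall v,
    m' * backward q (a :: s) v <= backward p (a :: s) v
      <= m' * ((1 + (1 - nu) * h) * (1 + tv_dist p q / nu ^+ 2) ^+ 2)
         * backward q (a :: s) v.
Proof.
move=> m0 h0 H; set del := tv_dist p q / nu ^+ 2.
have del0 : 0 <= del by rewrite divr_ge0 ?tv_dist_ge0// exprn_ge0// ltW.
have [c c0 cb] := backward_bounds q s.
have bp := bounded_measurable_backward p s.
have bq := bounded_measurable_backward q s.
have Iq : 0 < \int[p]_w backward q s w.
  apply: (@lt_le_trans _ _ (nu * c)); first exact: mulr_gt0.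
  rewrite -(prob_Rintegral_cst p (nu * c)); apply: prob_le_Rintegral => //.
    exact: bounded_measurable_cst.
  by move=> w; have /andP[] := cb w.
have [m1 m10 Hm1] := doeblin_contraction nu0 nu1 m0 h0 bp bq Iq H.
exists (m1 / (1 + del)) => [|v].
  by rewrite divr_gt0// ltr_pwDl.
have := Hm1 _ (bounded_measurable_section a v) (K_bounds a v) (backward_ge0 q s).
have kc w : nu ^+ 2 * c <= K a v w * backward q s w <= c.
  have /andP[k0 k1] := K_bounds a v w; have /andP[b0 b1] := cb w.
  apply/andP; split.
    by rewrite expr2 -mulrA ler_pM// ?mulr_ge0// ltW.
  by rewrite -[leRHS]mul1r ler_pM// ?backward_ge0// (le_trans (ltW nu0)).
have [mk _] := bounded_measurable_section_backward q a s v.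
have nu20 : 0 < nu ^+ 2 by rewrite exprn_gt0.
have t1 := tv_dist_ratio p q c0 nu20 mk kc.
have t2 := tv_dist_ratio q p c0 nu20 mk kc.
rewrite (tv_distC q p) -/del in t2; rewrite -/del in t1.
rewrite /=; move: t1 t2.
set I1 := \int[p]_w (K a v w * backward q s w).
set I2 := \int[q]_w (K a v w * backward q s w).
set I3 := \int[p]_w (K a v w * backward p s w).
move=> t1 t2 /andP[u1 u2].
have d1 : 0 < 1 + del by rewrite ltr_pwDl.
apply/andP; split.
  apply: le_trans u1; rewrite -mulrA ler_pM2l// ler_pdivrMl//.
apply: (le_trans u2).
have -> : m1 / (1 + del) * ((1 + (1 - nu) * h) * (1 + del) ^+ 2) * I2 =
   m1 * (1 + (1 - nu) * h) * ((1 + del) * I2).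
  by field; rewrite gt_eqF.
rewrite ler_wpM2l// mulr_ge0 ?(ltW m10)// addr_ge0// mulr_ge0// subr_ge0//.
Qed.

(** Chosen so that [stability_rate * (nu / 2)] is the inverse of [nu ^+ 2], the spread of the ratio
    of two backward functions of a nonempty word under arbitrary hidden laws. *)
Definition stability_rate : R := 2 / nu ^+ 3.

Lemma backward_stable p q s :
  let dl := (1 + tv_dist p q / nu ^+ 2) ^+ 2 - 1 in
  exists2 m : R, 0 < m & forall v,
    m * backward q s v <= backward p s v
      <= m * (1 + stability_rate * dl) * backward q s v.
Proof.
move=> dl; set h := stability_rate * dl.
have del0 : 0 <= tv_dist p q / nu ^+ 2.
  by rewrite divr_ge0 ?tv_dist_ge0// exprn_ge0// ltW.
have dl0 : 0 <= dl.
  by rewrite /dl; move: del0; set x := _ / _ => x0; nra.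
have nu30 : 0 < nu ^+ 3 by rewrite exprn_gt0.
have rate0 : 0 < stability_rate by rewrite divr_gt0.
have h0 : 0 <= h by rewrite mulr_ge0// ltW.
have base : exists2 m : R, 0 < m & forall v : V,
    m * backward q [::] v <= backward p [::] v
      <= m * (1 + h) * backward q [::] v.
  by exists 1 => // v /=; rewrite !mul1r mulr1 lexx lerDl.
have nuV : 1 <= nu^-1 by rewrite invf_ge1.
(* For a small perturbation the factor [1 + h] is preserved by one step, because
   [dl + h * dl <= nu * h]: each of the two terms is at most half of the right-hand side. *)
have [dls|dlb] := leP dl (nu / 2).
  elim: s => [//|a s [m m0 Hm]].
  have [m1 m10 Hm1] := backward_step a m0 h0 Hm.
  exists m1 => // v; have /andP[-> H2] := Hm1 v; apply: (le_trans H2).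
  rewrite ler_wpM2r ?backward_ge0// ler_wpM2l ?(ltW m10)//.
  have -> : (1 + tv_dist p q / nu ^+ 2) ^+ 2 = 1 + dl by rewrite /dl [RHS]addrC subrK.
  have e1 : dl <= nu / 2 * h.
    rewrite /h /stability_rate mulrA.
    have -> : nu / 2 * (2 / nu ^+ 3) = (nu^-1) ^+ 2 by field; rewrite gt_eqF.
    by rewrite ler_peMl// exprn_ege1.
  have e2 : h * dl <= h * (nu / 2) by rewrite ler_wpM2l.
  have e3 : 0 <= nu * h * dl by exact: mulr_ge0 (mulr_ge0 (ltW nu0) h0) dl0.
  lra.
case: s => [//|a s].
have lp := lik_gt0 p s; have lq := lik_gt0 q s.
exists (nu * lik p s / lik q s) => [|v]; first by rewrite divr_gt0// mulr_gt0.
have /andP[p1 p2] := backward_cons_bounds p a s v.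
have /andP[q1 q2] := backward_cons_bounds q a s v.
apply/andP; split.
  apply: le_trans p1; rewrite -mulrA ler_piMr//.
    by rewrite mulr_ge0// ltW.
  by rewrite ler_pdivrMl// mulr1.
apply: (le_trans p2).
have e1 : (nu ^+ 2)^-1 <= h.
  have -> : (nu ^+ 2)^-1 = stability_rate * (nu / 2).
    by rewrite /stability_rate; field; rewrite gt_eqF.
  by rewrite /h ler_wpM2l// ltW.
have e2 : lik p s <= nu * lik p s / lik q s * (nu ^+ 2)^-1 * backward q (a :: s) v.
  apply: (@le_trans _ _ (nu * lik p s / lik q s * (nu ^+ 2)^-1 * (nu * lik q s))).
    by rewrite le_eqVlt; apply/orP; left; apply/eqP; field; rewrite !gt_eqF.
  apply: ler_wpM2l q1; rewrite mulr_ge0//; last by rewrite invr_ge0 exprn_ge0// ltW.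
  by rewrite divr_ge0// ?mulr_ge0// ltW.
apply: (le_trans e2); rewrite ler_wpM2r ?backward_ge0// ler_wpM2l//.
  by rewrite ltW// divr_gt0// mulr_gt0.
by rewrite (le_trans e1)// lerDr.
Qed.

(** This compares the conditional probabilities of [a] given [s], in cross-multiplied form. The
    scale [m] cancels between numerator and denominator. Exchanging [p] and [q] costs one factor per
    integral: two for [lik p (a :: s)] and one for [lik q s]. *)
Lemma lik_predictive_tv p q a s :
  lik p (a :: s) * lik q s <=
  (1 + stability_rate * ((1 + tv_dist p q / nu ^+ 2) ^+ 2 - 1))
    * (1 + tv_dist p q / nu ^+ 2) ^+ 3 * (lik p s * lik q (a :: s)).
Proof.
have [m m0 Hm] := backward_stable p q s.
move: Hm; set h := stability_rate * _; set del := tv_dist p q / nu ^+ 2 => Hm.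
have del0 : 0 <= del by rewrite divr_ge0 ?tv_dist_ge0// exprn_ge0// ltW.
have d1 : 0 < 1 + del by rewrite ltr_pwDl.
have dl0 : 0 <= (1 + del) ^+ 2 - 1 by nra.
have h0 : 0 <= h.
  by rewrite mulr_ge0// divr_ge0// exprn_ge0// ltW.
have bc (c : R) : bounded_measurable (fun _ : V => c) by exact: bounded_measurable_cst.
have bb r u := bounded_measurable_backward r u.
have nu20 : 0 < nu ^+ 2 by rewrite exprn_gt0.
have [c c0 cb] := backward_bounds q s.
have le21 (x : R) : 0 < x -> nu ^+ 2 * x <= nu * x.
  by move=> x0; rewrite ler_wpM2r ?(ltW x0)// expr2 ler_piMl// ltW.
have step v : \int[p]_w (K a v w * backward p s w) <=
    m * (1 + h) * (1 + del) * backward q (a :: s) v.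
  have kc w : nu ^+ 2 * c <= K a v w * backward q s w <= c.
    have /andP[k0 k1] := K_bounds a v w; have /andP[b0 b1] := cb w.
    apply/andP; split.
      by rewrite expr2 -mulrA ler_pM// ?mulr_ge0// ltW.
    by rewrite -[leRHS]mul1r ler_pM// ?backward_ge0// (le_trans (ltW nu0)).
  have bk := bounded_measurable_section_backward q a s v.
  have := tv_dist_ratio p q c0 nu20 bk.1 kc; rewrite -/del => t1.
  apply: (@le_trans _ _ (m * (1 + h) * \int[p]_w (K a v w * backward q s w))).
    rewrite -prob_RintegralZl//; apply: prob_le_Rintegral.
    - exact: bounded_measurable_section_backward.
    - exact: bounded_measurableM.
    - move=> w; rewrite [leRHS]mulrCA ler_wpM2l//; last by have /andP[] := Hm w.
      by have /andP[k0 _] := K_bounds a v w; exact: le_trans (ltW nu0) k0.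
  rewrite -[leRHS]mulrA; apply: ler_wpM2l t1.
  exact: mulr_ge0 (ltW m0) (addr_ge0 ler01 h0).
have up : lik p (a :: s) <= m * (1 + h) * (1 + del) ^+ 2 * lik q (a :: s).
  apply: (@le_trans _ _ (m * (1 + h) * (1 + del) * \int[p]_v backward q (a :: s) v)).
    rewrite -prob_RintegralZl//; apply: prob_le_Rintegral => //.
    exact: bounded_measurableM.
  have cq v : nu ^+ 2 * lik q s <= backward q (a :: s) v <= lik q s.
    have /andP[q1 ->] := backward_cons_bounds q a s v; rewrite andbT.
    exact: le_trans (le21 _ (lik_gt0 q s)) q1.
  have := tv_dist_ratio p q (lik_gt0 q s) nu20 (bb q (a :: s)).1 cq.
  rewrite -/del => t1.
  rewrite expr2 mulrA -[leRHS]mulrA ler_wpM2l// !mulr_ge0// ?(ltW m0)// ?addr_ge0//.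
have low : m * lik q s <= (1 + del) * lik p s.
  have c2 v : nu ^+ 2 * c <= backward q s v <= c.
    by have /andP[q1 ->] := cb v; rewrite andbT (le_trans (le21 _ c0)).
  have := tv_dist_ratio q p c0 nu20 (bb q s).1 c2.
  rewrite tv_distC -/del => t1.
  apply: (@le_trans _ _ (m * ((1 + del) * \int[p]_v backward q s v))).
    by rewrite ler_wpM2l// ltW.
  rewrite mulrCA ler_wpM2l ?(ltW d1)// -prob_RintegralZl//.
  apply: prob_le_Rintegral => //; first exact: bounded_measurableM.
  by move=> v; have /andP[] := Hm v.
have lq0 := lik_gt0 q s; have lqa := lik_gt0 q (a :: s).
apply: (@le_trans _ _ (m * (1 + h) * (1 + del) ^+ 2 * lik q (a :: s) * lik q s)).
  by rewrite ler_wpM2r// ltW.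
have -> : m * (1 + h) * (1 + del) ^+ 2 * lik q (a :: s) * lik q s =
  (1 + h) * (1 + del) ^+ 2 * lik q (a :: s) * (m * lik q s) by ring.
apply: (@le_trans _ _ ((1 + h) * (1 + del) ^+ 2 * lik q (a :: s) *
   ((1 + del) * lik p s))).
  by rewrite ler_wpM2l// !mulr_ge0// ?(ltW lqa)// ?addr_ge0// exprn_ge0// ltW.
by rewrite le_eqVlt; apply/orP; left; apply/eqP; ring.
Qed.

(** Convexity: on [[0, 1]] a product of two such affine functions lies below its chord. *)
Lemma affine_product (t x y A B : R) : 0 <= t <= 1 -> 0 <= x -> 0 <= y ->
  0 <= A -> A <= 1 + x * t -> 0 <= B -> B <= 1 + y * t ->
  A * B <= 1 + ((1 + x) * (1 + y) - 1) * t.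
Proof.
move=> /andP[t0 t1] x0 y0 A0 hA B0 hB.
apply: (le_trans (ler_pM A0 B0 hA hB)).
have : 0 <= x * y * t * (1 - t) by rewrite !mulr_ge0// subr_ge0.
lra.
Qed.

(** The slope of the chord, between distances 0 and 1, of the factor in [lik_predictive_tv]. The
    nested form is the one that repeated use of [affine_product] produces. *)
Definition predictive_const : R :=
  let b := (nu ^+ 2)^-1 in
  let g := stability_rate * ((1 + b) ^+ 2 - 1) in
  (1 + g) * (1 + ((1 + b) * (1 + ((1 + b) ^+ 2 - 1)) - 1)) - 1.

Lemma predictive_const_ge0 : 0 <= predictive_const.
Proof.
rewrite /predictive_const; set b := (nu ^+ 2)^-1.
have b0 : 0 <= b by rewrite invr_ge0 exprn_ge0// ltW.
have r0 : 0 <= stability_rate by rewrite divr_ge0// exprn_ge0// ltW.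
have b2 : 0 <= (1 + b) ^+ 2 - 1 by nra.
have g0 : 0 <= stability_rate * ((1 + b) ^+ 2 - 1) by exact: mulr_ge0.
rewrite subr_ge0 -[leLHS]mulr1 ler_pM//; first by rewrite lerDl.
rewrite addrC subrK -[leLHS]mulr1 ler_pM//; first by rewrite lerDl.
by rewrite addrC subrK exprn_ege1// lerDl.
Qed.

Lemma lik_predictive p q a s :
  lik p (a :: s) * lik q s <=
  (1 + predictive_const * tv_dist p q) * (lik p s * lik q (a :: s)).
Proof.
apply: (le_trans (lik_predictive_tv p q a s)).
rewrite ler_wpM2r ?mulr_ge0 ?(ltW (lik_gt0 _ _))//.
have t01 : 0 <= tv_dist p q <= 1 by rewrite tv_dist_ge0 tv_dist_le1.
have t0 := tv_dist_ge0 p q.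
rewrite mulrC -[_ / _]mulrC /predictive_const; set b := (nu ^+ 2)^-1.
set t := tv_dist p q in t01 t0 *.
have b0 : 0 <= b by rewrite invr_ge0 exprn_ge0// ltW.
have r0 : 0 <= stability_rate by rewrite divr_ge0// exprn_ge0// ltW.
have b2 : 0 <= (1 + b) ^+ 2 - 1 by nra.
have bt : 0 <= b * t by exact: mulr_ge0.
have s2 : (1 + b * t) ^+ 2 <= 1 + ((1 + b) ^+ 2 - 1) * t.
  by rewrite expr2 [(1 + b) ^+ 2]expr2; apply: affine_product => //;
    rewrite addr_ge0.
have s3 : (1 + b * t) ^+ 3 <= 1 + ((1 + b) * (1 + ((1 + b) ^+ 2 - 1)) - 1) * t.
  rewrite exprS; apply: affine_product => //; rewrite ?addr_ge0//.
  by rewrite exprn_ge0// addr_ge0.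
rewrite mulrC; apply: affine_product => //.
- by rewrite mulr_ge0.
- by rewrite [1 + (_ - 1)]addrC subrK -exprS subr_ge0 exprn_ege1// lerDl.
- rewrite addr_ge0// mulr_ge0// subr_ge0 exprn_ege1// lerDl//.
- rewrite lerD2l -mulrA ler_wpM2l//; lra.
- by rewrite exprn_ge0// addr_ge0.
Qed.

Lemma ln_lik_lipschitz p q s :
  ln (lik p s) <= ln (lik q s) + (size s)%:R * (predictive_const * tv_dist p q).
Proof.
set e := predictive_const * _.
have e0 : 0 <= e by rewrite mulr_ge0 ?predictive_const_ge0 ?tv_dist_ge0.
elim: s => [|a s ih]; first by rewrite !lik_nil mul0r addr0.
have := lik_predictive p q a s; rewrite -/e => h.
have ln_le (x y : R) : 0 < x -> x <= y -> ln x <= ln y.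
  by move=> x0 xy; rewrite ler_ln// posrE (lt_le_trans x0).
have := ln_le _ _ (mulr_gt0 (lik_gt0 p (a :: s)) (lik_gt0 q s)) h.
have e1 : 0 < 1 + e by rewrite ltr_pwDl.
rewrite !lnM ?posrE ?mulr_gt0 ?lik_gt0//.
have : ln (1 + e) <= e by apply: le_ln1Dx; lra.
by rewrite /= -natr1; lra.
Qed.

End likelihood.

(** * One-dependent words: concentration and chi-square *)

Section words.
Context {X : choiceType}.
Variable E : seq X.

(** Words grow by [rcons] so that, in a sum of [g (u ++ s)] over [u], splitting off the last letter
    of [u] moves it to the front of [s]. The inductions on length below generalise over this
    suffix. *)
Fixpoint words (n : nat) : seq (seq X) :=
  if n is m.+1 then [seq rcons u a | a <- E, u <- words m] else [:: [::]].

Lemma size_words n u : u \in words n -> size u = n.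
Proof.
elim: n u => [|n ih] u /=; first by rewrite inE => /eqP ->.
by move=> /allpairsP[[a w] /= [_ /ih wn ->]]; rewrite size_rcons wn.
Qed.

Lemma mem_words n u : (forall x, x \in E) -> size u = n -> u \in words n.
Proof.
move=> EE; elim/last_ind: u n => [|u a ih] n; first by move=> <-; rewrite inE.
rewrite size_rcons => <- /=; apply/allpairsP; exists (a, u) => /=.
by split => //; exact: ih.
Qed.

Lemma uniq_words n : uniq E -> uniq (words n).
Proof.
move=> uE; elim: n => //= n ih; apply: allpairs_uniq => //.
by move=> [a u] [b w] _ _ /= /rcons_inj[-> ->].
Qed.

Lemma sum_words_rcons {R : nmodType} n (g : seq X -> R) :
  \sum_(u <- words n.+1) g u =
  \sum_(a <- E) \sum_(u <- words n) g (rcons u a).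
Proof. by rewrite /= big_allpairs_dep. Qed.

Lemma sum_words0 {R : nmodType} (g : seq X -> R) :
  \sum_(u <- words 0) g u = g [::].
Proof. by rewrite /= big_seq1. Qed.

Lemma sum_words_cat {R : nmodType} n m (g : seq X -> R) :
  \sum_(u <- words (n + m)) g u =
  \sum_(s <- words m) \sum_(u <- words n) g (u ++ s).
Proof.
elim: m g => [|m ih] g.
  by rewrite addn0 sum_words0; apply: eq_bigr => u _; rewrite cats0.
rewrite addnS !sum_words_rcons; apply: eq_bigr => a _.
rewrite ih; apply: eq_bigr => s _; apply: eq_bigr => u _.
by rewrite rcons_cat.
Qed.

End words.

(** * Real inequalities and nearly additive sequences *)

Section real_inequalities.
Context {R : realType}.

Lemma expR_quadratic (y : R) : y <= 1 / 2 -> expR y <= 1 + y + 2 * y ^+ 2.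
Proof.
move=> y2; have y1 : 0 < 1 - y by lra.
have h : 1 - y <= expR (- y) by have := @expR_ge1Dx R (- y); lra.
rewrite -[expR y]invrK -expRN.
apply: (@le_trans _ _ (1 - y)^-1).
  by rewrite lef_pV2// posrE expR_gt0.
rewrite -[leLHS]mul1r ler_pdivrMr//.
have : 0 <= y ^+ 2 * (1 / 2 - y) by rewrite mulr_ge0 ?sqr_ge0// subr_ge0.
lra.
Qed.

Lemma near_additive_mul (e : nat -> R) (D : R) :
  (forall j k, `|e (j + k)%N - e j - e k| <= D) ->
  forall k j, `|e (k.+1 * j)%N - k.+1%:R * e j| <= k.+1%:R * D.
Proof.
move=> eD; have D0 : 0 <= D by exact: le_trans (normr_ge0 _) (eD 0%N 0%N).
elim=> [|k ih] j; first by rewrite mul1n !mul1r subrr normr0.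
have := eD j (k.+1 * j)%N; rewrite -mulSn.
have := ih j; rewrite !ler_norml -[k.+2%:R]natr1.
by move=> /andP[a1 a2] /andP[a3 a4]; apply/andP; split; lra.
Qed.

(** A two-sided Fekete argument: comparing [e (j * k)] with [j * e k] and with [k * e j] shows that
    every [(e j - D) / j] is below every [(e k + D) / k], and [L] is a separating point. *)
Lemma near_additive_limit (e : nat -> R) (D : R) :
  (forall j k, `|e (j + k)%N - e j - e k| <= D) ->
  exists L : R, forall n, `|e n - n%:R * L| <= D.
Proof.
move=> eD; have D0 : 0 <= D by exact: le_trans (normr_ge0 _) (eD 0%N 0%N).
have cross j k : (e j.+1 - D) / j.+1%:R <= (e k.+1 + D) / k.+1%:R.
  rewrite ler_pdivrMr ?ltr0n// mulrAC ler_pdivlMr ?ltr0n//.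
  have := near_additive_mul eD j k.+1; have := near_additive_mul eD k j.+1.
  rewrite mulnC !ler_norml => /andP[a1 a2] /andP[a3 a4]; lra.
pose S := [set (e n.+1 - D) / n.+1%:R | n in [set: nat]].
have Sub k : ubound S ((e k.+1 + D) / k.+1%:R) by move=> _ [j _ <-]; exact: cross.
exists (sup S) => -[|n].
  rewrite mul0r subr0; have := eD 0%N 0%N; rewrite addn0.
  by rewrite subrr sub0r normrN.
have h1 : (e n.+1 - D) / n.+1%:R <= sup S.
  by apply: ub_le_sup; [exists ((e 1%N + D) / 1%:R); exact: Sub | exists n].
have h2 : sup S <= (e n.+1 + D) / n.+1%:R.
  by apply: ge_sup; [exists ((e 1%N - D) / 1%:R), 0%N | exact: Sub].
move: h1 h2; rewrite ler_pdivrMr ?ltr0n// ler_pdivlMr ?ltr0n// ler_norml => h1 h2.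
by apply/andP; split; lra.
Qed.

End real_inequalities.

(** * Martingale concentration for one-dependent words *)

Section one_dependent_chain.
Context {R : realType} {X : choiceType}.
Variables (E : seq X) (p : seq X -> R).
Hypothesis p_gt0 : forall s, 0 < p s.
Hypothesis p_nil : p [::] = 1.
Hypothesis p_dep : forall u s, \sum_(b <- E) p (u ++ b :: s) = p u * p s.

Lemma sum_cons s : \sum_(a <- E) p (a :: s) = p s.
Proof. by have := p_dep [::] s; rewrite p_nil mul1r. Qed.

Lemma sum_words_suffix n s : \sum_(u <- words E n) p (u ++ s) = p s.
Proof.
elim: n s => [|n ih] s; first by rewrite sum_words0.
rewrite sum_words_rcons -[RHS]sum_cons; apply: eq_bigr => a _.
by rewrite -ih; apply: eq_bigr => u _; rewrite cat_rcons.
Qed.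

Lemma sum_words_total n : \sum_(u <- words E n) p u = 1.
Proof.
by have := sum_words_suffix n [::]; under eq_bigr do rewrite cats0; rewrite p_nil.
Qed.

Variables (f : seq X -> R) (C : R).
Hypothesis f_nil : f [::] = 0.
Hypothesis f_add : forall u b s, `|f (u ++ b :: s) - f u - f s| <= C.

(** The Doob martingale of [f]: its conditional expectation given the last letters [s], with [j]
    letters still to be revealed on the left. *)
Definition cond_mean j s := (\sum_(u <- words E j) p (u ++ s) * f (u ++ s)) / p s.

Definition mean j := \sum_(u <- words E j) p u * f u.

Lemma cond_mean_nil j : cond_mean j [::] = mean j.
Proof.
by rewrite /cond_mean p_nil divr1; apply: eq_bigr => u _; rewrite cats0.
Qed.

Lemma cond_mean0 s : cond_mean 0 s = f s.
Proof. by rewrite /cond_mean sum_words0 cat0s mulrC mulKf// gt_eqF. Qed.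

Lemma mean0 : mean 0 = 0.
Proof. by rewrite -cond_mean_nil cond_mean0. Qed.

Lemma cond_meanS j s :
  p s * cond_mean j.+1 s = \sum_(a <- E) p (a :: s) * cond_mean j (a :: s).
Proof.
rewrite /cond_mean mulrC divfK ?gt_eqF// sum_words_rcons; apply: eq_bigr => a _.
rewrite mulrC divfK ?gt_eqF//; apply: eq_bigr => u _.
by rewrite cat_rcons.
Qed.

(** Of the [j.+1] unrevealed letters, the one next to [s] is sacrificed: summing it out makes the
    other [j] independent of [s], while [f] splits across it up to [C]. *)
Lemma cond_mean_approx j s : `|cond_mean j.+1 s - mean j - f s| <= C.
Proof.
have ps := p_gt0 s.
have -> : cond_mean j.+1 s - mean j - f s =
   (\sum_(b <- E) \sum_(u <- words E j)
      p (u ++ b :: s) * (f (u ++ b :: s) - f u - f s)) / p s.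
  have e1 : \sum_(b <- E) \sum_(u <- words E j)
      p (u ++ b :: s) * (f u + f s) = p s * (mean j + f s).
    rewrite exchange_big /=.
    transitivity (\sum_(u <- words E j) p s * (p u * f u + p u * f s)).
      apply: eq_bigr => u _; rewrite -mulr_suml p_dep; ring.
    by rewrite -mulr_sumr big_split /= -mulr_suml sum_words_total mul1r.
  have e2 : p s * cond_mean j.+1 s =
      \sum_(b <- E) \sum_(u <- words E j) p (u ++ b :: s) * f (u ++ b :: s).
    rewrite /cond_mean mulrC divfK ?gt_eqF// sum_words_rcons.
    by apply: eq_bigr => a _; apply: eq_bigr => u _; rewrite cat_rcons.
  apply: (canRL (mulfK _)); first by rewrite gt_eqF.
  rewrite -addrA -opprD mulrC mulrBr e2 -e1 -sumrB; apply: eq_bigr => b _.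
  by rewrite -sumrB; apply: eq_bigr => u _; ring.
rewrite normrM normfV (gtr0_norm ps) ler_pdivrMr//.
apply: (le_trans (ler_norm_sum _ _ _)).
have -> : C * p s = \sum_(b <- E) \sum_(u <- words E j) C * p (u ++ b :: s).
  rewrite -sum_cons mulr_sumr; apply: eq_bigr => b _.
  by rewrite -mulr_sumr sum_words_suffix.
apply: ler_sum => b _; apply: (le_trans (ler_norm_sum _ _ _)).
apply: ler_sum => u _; rewrite normrM (gtr0_norm (p_gt0 _)) mulrC.
by rewrite ler_wpM2r// ltW.
Qed.

Lemma mean_step j : `|mean j.+1 - mean j| <= C.
Proof.
by have := cond_mean_approx j [::]; rewrite cond_mean_nil f_nil subr0.
Qed.

(** Four errors of size [C]: one approximation for each conditional mean, one step of [mean], and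
    the effect of [a] on [f]. *)
Lemma bounded_increments j a s :
  `|cond_mean j (a :: s) - cond_mean j.+1 s| <= 4 * C.
Proof.
have C0 : 0 <= C by exact: le_trans (normr_ge0 _) (mean_step 0).
have := f_add [::] a s; rewrite f_nil subr0 cat0s.
have := cond_mean_approx j s.
case: j => [|j]; rewrite ?cond_mean0 ?mean0 ?subr0 => h1 h2.
  move: h1 h2; rewrite !ler_norml => /andP[? ?] /andP[? ?].
  by apply/andP; split; lra.
have := cond_mean_approx j (a :: s); have := mean_step j.
move: h1 h2; rewrite !ler_norml => /andP[? ?] /andP[? ?] /andP[? ?] /andP[? ?].
by apply/andP; split; lra.
Qed.

(** One [C] for the letter sacrificed between the two blocks, one for restoring it through
    [mean_step]. *)
Lemma mean_near_additive j k : `|mean (j + k) - mean j - mean k| <= 2 * C.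
Proof.
have C0 : 0 <= C by exact: le_trans (normr_ge0 _) (mean_step 0).
case: j => [|j].
  by rewrite add0n mean0 subr0 subrr normr0 mulr_ge0.
have meanE : mean (j.+1 + k) = \sum_(s <- words E k) p s * cond_mean j.+1 s.
  rewrite /mean sum_words_cat; apply: eq_bigr => s _.
  by rewrite /cond_mean mulrC divfK// gt_eqF.
have : `|mean (j.+1 + k) - mean j - mean k| <= C.
  have -> : mean (j.+1 + k) - mean j - mean k =
      \sum_(s <- words E k) p s * (cond_mean j.+1 s - mean j - f s).
    rewrite meanE -[in LHS](mul1r (mean j)) -{1}(sum_words_total k) mulr_suml.
    by rewrite -!sumrB; apply: eq_bigr => s _; ring.
  apply: (le_trans (ler_norm_sum _ _ _)).
  rewrite -[leRHS]mul1r -(sum_words_total k) mulr_suml; apply: ler_sum => s _.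
  rewrite normrM (gtr0_norm (p_gt0 _)) ler_wpM2l//; first exact: ltW.
  exact: cond_mean_approx.
have := mean_step j.
rewrite !ler_norml => /andP[? ?] /andP[? ?]; by apply/andP; split; lra.
Qed.

(** Azuma's induction, one letter at a time: the increment is at most [4 * C], the linear term of
    the exponential averages to zero by [cond_meanS], and the quadratic term gives the variance
    proxy. *)
Lemma mgf_bound (lam : R) j s : `|lam| * (4 * C) <= 1 / 2 ->
  \sum_(u <- words E j) p (u ++ s) * expR (lam * f (u ++ s)) <=
  p s * expR (lam * cond_mean j s + j%:R * (2 * (lam * (4 * C)) ^+ 2)).
Proof.
move=> lamC; set D := 2 * (lam * (4 * C)) ^+ 2.
elim: j s => [|j ih] s.
  by rewrite sum_words0 cat0s cond_mean0 mul0r addr0.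
rewrite sum_words_rcons.
apply: (@le_trans _ _ (\sum_(a <- E)
    p (a :: s) * expR (lam * cond_mean j (a :: s) + j%:R * D))).
  apply: ler_sum => a _; apply: le_trans (ih _).
  by apply: ler_sum => u _; rewrite cat_rcons.
pose y a := lam * (cond_mean j (a :: s) - cond_mean j.+1 s).
have yle a : `|y a| <= `|lam| * (4 * C).
  by rewrite normrM ler_wpM2l// bounded_increments.
have -> : \sum_(a <- E) p (a :: s) * expR (lam * cond_mean j (a :: s) + j%:R * D)
   = expR (lam * cond_mean j.+1 s + j%:R * D) * \sum_(a <- E) p (a :: s) * expR (y a).
  rewrite mulr_sumr; apply: eq_bigr => a _; rewrite [RHS]mulrCA -expRD.
  by congr (_ * expR _); rewrite /y; ring.
have -> : lam * cond_mean j.+1 s + j.+1%:R * D =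
    (lam * cond_mean j.+1 s + j%:R * D) + D by rewrite -natr1; ring.
rewrite [in leRHS]expRD [leRHS]mulrCA ler_wpM2l ?expR_ge0//.
apply: (@le_trans _ _ (\sum_(a <- E) (p (a :: s) * (1 + D) + p (a :: s) * y a))).
  apply: ler_sum => a _; rewrite -mulrDr ler_wpM2l ?(ltW (p_gt0 _))//.
  have ya : y a <= 1 / 2 := le_trans (ler_norm _) (le_trans (yle a) lamC).
  apply: (le_trans (expR_quadratic ya)).
  have : y a ^+ 2 <= (lam * (4 * C)) ^+ 2.
    rewrite -[_ ^+ 2]ger0_norm ?sqr_ge0// -[leRHS]ger0_norm ?sqr_ge0//.
    rewrite !normrX; apply: lerXn2r; rewrite ?nnegrE//.
    apply: (le_trans (yle a)); rewrite normrM ler_wpM2l//; exact: ler_norm.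
  rewrite /D; lra.
rewrite big_split /= -mulr_suml sum_cons.
have -> : \sum_(a <- E) p (a :: s) * y a = 0.
  have -> : \sum_(a <- E) p (a :: s) * y a =
    lam * (\sum_(a <- E) p (a :: s) * cond_mean j (a :: s)
       - \sum_(a <- E) p (a :: s) * cond_mean j.+1 s).
    by rewrite -sumrB mulr_sumr; apply: eq_bigr => a _; rewrite /y; ring.
  by rewrite -cond_meanS -mulr_suml sum_cons subrr mulr0.
by rewrite addr0 ler_wpM2l ?(ltW (p_gt0 _))// expR_ge1Dx.
Qed.

Lemma tail_bound (lam t : R) n : 0 <= lam -> lam * (4 * C) <= 1 / 2 ->
  \sum_(u <- words E n | mean n + n%:R * t < f u) p u <=
  expR (n%:R * (2 * (lam * (4 * C)) ^+ 2 - lam * t)).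
Proof.
move=> lam0 lamC.
have := @mgf_bound lam n [::]; rewrite (ger0_norm lam0) => /(_ lamC).
rewrite p_nil mul1r cond_mean_nil.
under eq_bigr do rewrite cats0.
set D := 2 * _ => h.
have -> : n%:R * (D - lam * t) = (lam * mean n + n%:R * D) - lam * (mean n + n%:R * t).
  by ring.
rewrite expRB ler_pdivlMr ?expR_gt0//; apply: le_trans h.
rewrite big_mkcond mulr_suml; apply: ler_sum => u _.
case: ifPn => [fu|_]; last by rewrite mul0r mulr_ge0 ?expR_ge0 ?(ltW (p_gt0 _)).
rewrite ler_wpM2l ?(ltW (p_gt0 _))// ler_expR ler_wpM2l//; exact: ltW.
Qed.

Lemma tail_exponential (t : R) : 0 < t -> exists2 k : R, 0 < k & forall n,
  \sum_(u <- words E n | mean n + n%:R * t < f u) p u <= expR (- (k * n%:R)).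
Proof.
move=> t0; have C0 : 0 <= C by exact: le_trans (normr_ge0 _) (mean_step 0).
(* The added 1 keeps [D] positive when [C] is 0. In [lam], the first bound meets the condition of
   [tail_bound]; the second makes the quadratic term at most half of [lam * t]. *)
pose D := 4 * C + 1; have D0 : 0 < D by rewrite /D; lra.
pose lam := Num.min (2 * D)^-1 (t / (4 * D ^+ 2)).
have l1 : lam <= (2 * D)^-1 by rewrite ge_min lexx.
have l2 : lam <= t / (4 * D ^+ 2) by rewrite ge_min lexx orbT.
have DD : 0 < 4 * D ^+ 2 by rewrite mulr_gt0// exprn_gt0.
have lam0 : 0 < lam by rewrite lt_min invr_gt0 mulr_gt0//= divr_gt0.
exists (lam * t / 2) => [|n]; first by rewrite divr_gt0// mulr_gt0.
have lamC : lam * (4 * C) <= 1 / 2.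
  apply: (@le_trans _ _ (lam * D)); first by rewrite ler_pM2l// /D; lra.
  move: l1; rewrite -[leRHS]mul1r ler_pdivlMr ?mulr_gt0//; lra.
apply: (le_trans (tail_bound t n (ltW lam0) lamC)).
rewrite ler_expR.
have h1 : (lam * (4 * C)) ^+ 2 <= (lam * D) ^+ 2.
  apply: lerXn2r; rewrite ?nnegrE ?mulr_ge0 ?(ltW lam0) ?(ltW D0)//.
  by rewrite ler_pM2l// /D; lra.
have h2 : lam * (lam * (4 * D ^+ 2)) <= lam * t.
  by rewrite ler_pM2l// -ler_pdivlMr.
have : n%:R * (2 * (lam * (4 * C)) ^+ 2 - lam * t) <= n%:R * (- (lam * t / 2)).
  by rewrite ler_wpM2l//; move: h1 h2; rewrite exprMn; lra.
lra.
Qed.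

End one_dependent_chain.

(** * Chi-square divergence along a word *)

Section chi_square.
Context {R : realType} {X : choiceType}.
Variables (E : seq X) (p q : seq X -> R) (e : R).
Hypotheses (p_gt0 : forall s, 0 < p s) (q_gt0 : forall s, 0 < q s).
Hypothesis p_sum : forall s, \sum_(a <- E) p (a :: s) = p s.
Hypothesis q_sum : forall s, \sum_(a <- E) q (a :: s) = q s.
Hypothesis e_ge0 : 0 <= e.
Hypothesis pq : forall a s, p (a :: s) * q s <= (1 + e) * (p s * q (a :: s)).
Hypothesis qp : forall a s, q (a :: s) * p s <= (1 + e) * (q s * p (a :: s)).

(** If [r] is the ratio of the conditional probabilities of [a] given [s] under [p] and [q], then
    [pq] and [qp] give [|r - 1| <= e], and the claim is the square of this, expanded. After
    summation over [a] no term linear in [e] survives: the factor is [1 + e ^+ 2]. *)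
Lemma chi_square_step a s : p (a :: s) ^+ 2 / q (a :: s) <=
  2 * (p s / q s) * p (a :: s) + (e ^+ 2 - 1) * (p s / q s) ^+ 2 * q (a :: s).
Proof.
have A0 := p_gt0 s; have B0 := q_gt0 s.
have x0 := p_gt0 (a :: s); have y0 := q_gt0 (a :: s).
have := pq a s; have := qp a s.
move: (p s) (q s) (p (a :: s)) (q (a :: s)) A0 B0 x0 y0 => A B x y A0 B0 x0 y0 h2 h1.
rewrite ler_pdivrMr// -subr_ge0.
have -> : (2 * (A / B) * x + (e ^+ 2 - 1) * (A / B) ^+ 2 * y) * y - x ^+ 2 =
   ((e * (A * y)) ^+ 2 - (x * B - A * y) ^+ 2) / B ^+ 2.
  by field; rewrite gt_eqF.
rewrite divr_ge0 ?sqr_ge0// subr_sqr.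
have eAy : 0 <= e * (A * y) by rewrite !mulr_ge0// ltW.
rewrite mulr_ge0//; first lra.
have [h|h] := leP (A * y) (x * B); first by lra.
have : e * (x * B) <= e * (A * y) by rewrite ler_wpM2l// ltW.
lra.
Qed.

Lemma chi_square_words n s :
  \sum_(u <- words E n) p (u ++ s) ^+ 2 / q (u ++ s) <=
  (1 + e ^+ 2) ^+ n * (p s ^+ 2 / q s).
Proof.
elim: n s => [|n ih] s; first by rewrite sum_words0 cat0s mul1r.
rewrite sum_words_rcons.
apply: (@le_trans _ _ (\sum_(a <- E)
    (1 + e ^+ 2) ^+ n * (p (a :: s) ^+ 2 / q (a :: s)))).
  apply: ler_sum => a _; apply: le_trans (ih _).
  by apply: ler_sum => u _; rewrite cat_rcons.
rewrite -mulr_sumr [(1 + e ^+ 2) ^+ n.+1]exprSr -[leRHS]mulrA.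
rewrite ler_wpM2l ?exprn_ge0 ?addr_ge0 ?sqr_ge0//.
apply: (le_trans (ler_sum _ (fun a _ => chi_square_step a s))).
rewrite big_split /= -!mulr_sumr p_sum q_sum le_eqVlt; apply/orP; left; apply/eqP.
by field; rewrite gt_eqF.
Qed.

End chi_square.

(** * Law of the observations *)

Section finite_alphabet.
Context {R : realType} {X : choiceType} {d : measure_display}
  {V : measurableType d}.

Lemma probability_inhabited (p : probability V R) : exists v : V, True.
Proof.
apply: contrapT => h; have := probability_setT p.
have -> : [set: V] = set0.
  by apply/seteqP; split => // v _; exfalso; apply: h; exists v.
by rewrite measure0 => /eqP; rewrite eqe eq_sym oner_eq0.
Qed.

(** More than [1 / nu] letters of mass at least [nu] each would exceed total mass 1. *)
Lemma emission_alphabet (K : X -> V -> V -> R) (nu : R) (v0 : V) :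
  emission_kernel K -> 0 < nu -> (forall x v w, nu <= K x v w) ->
  exists E : seq X, [/\ uniq E, forall x, x \in E &
    forall v w, \sum_(b <- E) K b v w = 1].
Proof.
move=> [Kr _ Kp] nu0 Knu.
have finX : finite_set [set: X].
  apply: contrapT => /(infinite_set_fset (Num.truncn nu^-1).+1)[B _ sB].
  have : ((\sum_(i <- finmap.enum_fset B) K i v0 v0)%:E <= 1%:E)%E.
    rewrite -sumEFin -(Kp v0 v0); apply: esum_ge; exists [set` finmap.enum_fset B].
      by split => //; apply/finite_seqP; exists (finmap.enum_fset B).
    by rewrite -fsbig_seq//; exact: finmap.fset_uniq.
  rewrite lee_fin; apply/negP; rewrite -ltNge.
  apply: (@lt_le_trans _ _ (\sum_(i <- finmap.enum_fset B) nu)); last first.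
    by apply: ler_sum => i _.
  rewrite big_const_seq count_predT iter_addr_0 -mulr_natl.
  rewrite -ltr_pdivrMr// mul1r; apply: (lt_le_trans (truncnS_gt _)).
  by rewrite ler_nat.
have /finite_seqP[s sE] := finX.
have uE : forall x, x \in undup s.
  by move=> x; rewrite mem_undup; have : [set: X] x by []; rewrite sE.
exists (undup s); split => //; first exact: undup_uniq.
move=> v w; have := Kp v w; rewrite esum_fset//; last first.
  by move=> i _; rewrite lee_fin; have /andP[] := Kr i v w.
have -> : [set: X] = [set` undup s] by apply/seteqP; split => // x _; exact: uE.
by rewrite -fsbig_seq ?undup_uniq// sumEFin => -[].
Qed.

End finite_alphabet.

(** * Powers of the hidden law *)

Section power_law.
Context {R : realType} {d : measure_display} {V : measurableType d}.
Implicit Types p : probability V R.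

Lemma ge0_integral_powerS p n (F : n.+1.-tuple V -> \bar R) :
  measurable_fun setT F -> (forall t, 0 <= F t)%E ->
  (\int[power_probability p n.+1]_t F t =
   \int[p]_v \int[power_probability p n]_t F [tuple of v :: t])%E.
Proof.
move=> mF F0; rewrite /= ge0_integral_distribution// fubini_tonelli1//.
  by apply: measurableT_comp => //; exact: measurable_tuple_cons.
by move=> z; exact: F0.
Qed.

Definition rectangle n (B : nat -> set V) : set (n.-tuple V) :=
  [set t | forall i : 'I_n, B i (tnth t i)].

Lemma measurable_rectangle n (B : nat -> set V) : (forall i, measurable (B i)) ->
  measurable (@rectangle n B).
Proof.
move=> mB.
have -> : @rectangle n B = \bigcap_(i in [set: 'I_n]) ((@tnth _ V)^~ i @^-1` B i).
  by apply/seteqP; split => [t h i _ | t h i]; [exact: h | exact: (h i)].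
apply: fin_bigcap_measurable => // i _.
by rewrite -[X in measurable X]setTI; exact: measurable_tnth.
Qed.

Lemma power_rectangle p n (B : nat -> set V) : (forall i, measurable (B i)) ->
  (power_probability p n (rectangle B) = \prod_(i < n) p (B i))%E.
Proof.
elim: n B => [|n ih] B mB.
  rewrite big_ord0 /= (_ : @rectangle 0 B = setT) ?diracT//.
  by apply/seteqP; split => // t _ [].
rewrite big_ord_recl /=.
have -> : @tuple_cons _ V n @^-1` rectangle B =
    B 0%N `*` @rectangle n (fun i => B i.+1).
  apply/seteqP; split => [[v t] /= h|[v t] /= [h0 h] i].
    split => /=; first by have := h ord0; rewrite tnth0.
    by move=> i; have := h (lift ord0 i); rewrite tnthS.
  case: (unliftP ord0 i) => [j ->|->]; last by rewrite tnth0.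
  by rewrite tnthS; exact: h.
rewrite product_measure1E//; last exact: measurable_rectangle.
by congr (_ * _)%E; exact: (ih (fun i => B i.+1)).
Qed.

(** Rectangles form a pi-system that generates the sigma-algebra of tuples; a cylinder is the
    rectangle that constrains a single coordinate. *)
Lemma tuple_measure_unique n (m1 m2 : probability (n.-tuple V) R) :
  (forall B : nat -> set V, (forall i, measurable (B i)) ->
     m1 (rectangle B) = m2 (rectangle B)) ->
  forall A, measurable A -> m1 A = m2 A.
Proof.
move=> h.
pose G := [set A | exists2 B : nat -> set V, forall i, measurable (B i) &
  A = @rectangle n B].
have GT : G setT by exists (fun=> setT) => //; apply/seteqP; split.
apply: (measure_unique G (fun=> setT)) => //.
- apply/seteqP; split.
    apply: smallest_sub; first exact: smallest_sigma_algebra.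
    rewrite -bigcup_seq => A [i _ [B mB <-]].
    apply: sub_sigma_algebra; exists (fun j : nat => if j == i then B else setT).
      by move=> j; case: ifP.
    rewrite setTI; apply/seteqP; split => [t Bt j|t Bt] /=.
      by case: eqP => // /val_inj ->.
    by have := Bt i; rewrite eqxx.
  apply: smallest_sub; first exact: sigma_algebra_measurable.
  by move=> _ [B mB ->]; exact: measurable_rectangle.
- move=> _ _ [A mA ->] [B mB ->]; exists (fun i => A i `&` B i).
    by move=> i; exact: measurableI.
  by apply/seteqP; split => [t [h1 h2] i|t ht]; [split | split => i; have [] := ht i].
- by rewrite bigcup_const//; exists 0%N.
- by move=> _ [B mB ->]; exact: h.
- by move=> _; apply: le_lt_trans (probability_le1 m1 measurableT) (ltry 1).
Qed.

End power_law.

Section likelihood_as_integral.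
Context {R : realType} {X : choiceType} {d : measure_display}
  {V : measurableType d}.
Variables (K : X -> V -> V -> R) (nu : R).
Hypotheses (nu0 : 0 < nu) (nu1 : nu <= 1).
Hypothesis K_bounds : forall x v w, nu <= K x v w <= 1.
Hypothesis K_measurable : forall x,
  measurable_fun [set: V * V] (fun vw => K x vw.1 vw.2).
Implicit Types p : probability V R.

Definition path_weight n (x : n.-tuple X) (v : n.+1.-tuple V) : R :=
  \prod_(i < n) K (tnth x i) (tnth v (widen_ord (leqnSn n) i))
                             (tnth v (lift ord0 i)).

Lemma path_weight_cons n a (x : n.-tuple X) v w (t : n.-tuple V) :
  path_weight [tuple of a :: x] [tuple of v :: [tuple of w :: t]] =
  K a v w * path_weight x [tuple of w :: t].
Proof.
rewrite /path_weight big_ord_recl tnth0; congr (K _ _ _ * _).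
apply: eq_bigr => i _; rewrite !tnthS; congr (K _ _ _).
rewrite (_ : widen_ord _ (lift ord0 i) =
  lift ord0 (widen_ord (leqnSn n) i)) ?tnthS//.
exact: val_inj.
Qed.

Lemma path_weight_01 n (x : n.-tuple X) v : 0 <= path_weight x v <= 1.
Proof.
have h i v' w : 0 <= K i v' w <= 1.
  have /andP[h1 ->] := K_bounds i v' w; rewrite andbT.
  exact: le_trans (ltW nu0) h1.
apply/andP; split; first by apply: prodr_ge0 => i _; have /andP[] := h
  (tnth x i) (tnth v (widen_ord (leqnSn n) i)) (tnth v (lift ord0 i)).
by apply: prodr_ile1 => i _.
Qed.

Lemma measurable_path_weight n (x : n.-tuple X) :
  measurable_fun setT (path_weight x).
Proof.
rewrite /path_weight; elim: (index_enum _) => [|i r ih].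
  by under eq_fun do rewrite big_nil; exact: measurable_cst.
under eq_fun do rewrite big_cons.
apply: measurable_funM => //.
have h : measurable_fun setT (fun v : n.+1.-tuple V =>
    (tnth v (widen_ord (leqnSn n) i), tnth v (lift ord0 i))).
  by apply: measurable_fun_pair; exact: measurable_tnth.
have := measurableT_comp (K_measurable (tnth x i)) h.
exact.
Qed.

Lemma measurable_path_weight_cons n (x : n.-tuple X) v :
  measurable_fun setT (fun t : n.-tuple V => path_weight x [tuple of v :: t]).
Proof.
have h : measurable_fun setT (fun t : n.-tuple V => [tuple of v :: t]).
  exact: measurable_cons (measurable_cst v) (@measurable_id _ _ setT).
have := measurableT_comp (measurable_path_weight x) h.
exact.
Qed.

(** By Tonelli the integral over all hidden variables, which defines [loglik], becomes the recursion
    [backward] that carries the estimates. *)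
Lemma integral_path_weight_cons p n (x : n.-tuple X) v :
  (\int[power_probability p n]_t (path_weight x [tuple of v :: t])%:E =
   (backward K p x v)%:E)%E.
Proof.
elim: n x v => [|n ih] x v.
  rewrite (tuple0 x) /=.
  under eq_integral do rewrite /path_weight big_ord0.
  by rewrite integral_cst// mul1e; exact: probability_setT.
case/tupleP: x => a x; rewrite ge0_integral_powerS; last 2 first.
- by apply/measurable_EFinP; exact: measurable_path_weight_cons.
- by move=> t; rewrite lee_fin; have /andP[] := path_weight_01
    [tuple of a :: x] [tuple of v :: t].
rewrite /= -EFin_Rintegral; last first.
  exact: (bounded_measurable_section_backward nu0 K_bounds K_measurable).
apply: eq_integral => w _.
under eq_integral do rewrite path_weight_cons EFinM.
rewrite ge0_integralZl ?ih ?EFinM//.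
- by apply/measurable_EFinP; exact: measurable_path_weight_cons.
- by move=> t _; rewrite lee_fin; have /andP[] := path_weight_01
    x [tuple of w :: t].
- by rewrite lee_fin (le_trans (ltW nu0))//; have /andP[] := K_bounds a v w.
Qed.

Lemma integral_path_weight p n (x : n.-tuple X) :
  (\int[power_probability p n.+1]_t (path_weight x t)%:E = (lik K p x)%:E)%E.
Proof.
rewrite ge0_integral_powerS; last 2 first.
- by apply/measurable_EFinP; exact: measurable_path_weight.
- by move=> t; rewrite lee_fin; have /andP[] := path_weight_01 x t.
under eq_integral do rewrite integral_path_weight_cons.
rewrite EFin_Rintegral//.
exact: (bounded_measurable_backward nu0 K_bounds K_measurable).
Qed.

Lemma loglikE p n (x : n.-tuple X) : loglik K p x = ln (lik K p x).
Proof.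
rewrite /loglik; congr ln.
by rewrite /Rintegral (integral_path_weight p x).
Qed.

Lemma expR_loglik p n (x : n.-tuple X) : expR (loglik K p x) = lik K p x.
Proof.
by rewrite loglikE lnK// posrE (lik_gt0 nu0 K_bounds K_measurable).
Qed.

(** * Probabilities of events about the observations *)

Section observed_process.
Context {dO : measure_display} {Omega : measurableType dO}.
Variables (P : probability Omega R) (Xs : int -> Omega -> X)
  (Vs : int -> Omega -> V) (pi : probability V R) (E : seq X).
Hypothesis XV : process_law K pi P Xs Vs.
Hypotheses (uE : uniq E) (memE : forall x, x \in E).

Definition hidden n (w : Omega) : n.-tuple V := [tuple Vs (i.+1)%:Z w | i < n].

Lemma measurable_hidden n : measurable_fun setT (hidden n).
Proof.
apply/measurable_fun_tnthP => i.
rewrite (_ : _ \o _ = Vs (i.+1)%:Z); first exact: (process_measurableV XV).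
by apply/funext => w /=; rewrite tnth_mktuple.
Qed.

Let positions n := [seq (i.+1)%:Z | i <- iota 0 n].

Let uniq_positions n : uniq (positions n).
Proof. by rewrite map_inj_uniq ?iota_uniq// => i j []. Qed.

Lemma hidden_rectangle n (B : nat -> set V) : (forall i, measurable (B i)) ->
  (P (hidden n @^-1` rectangle B) = \prod_(i < n) pi (B i))%E.
Proof.
(* Index [i] of a tuple is time [i + 1] of the process, whence the predecessor. *)
move=> mB; pose B' (z : int) := B (absz z).-1.
have -> : hidden n @^-1` rectangle B =
    \bigcap_(i in [set` positions n]) (Vs i @^-1` B' i).
  apply/seteqP; split => [w h z /= /mapP[i]|w h i] /=.
    rewrite mem_iota /= add0n => ilt ->; rewrite /B' /=.
    by have := h (Ordinal ilt); rewrite tnth_mktuple.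
  rewrite tnth_mktuple; apply: (h (i.+1)%:Z) => /=.
  by apply/mapP; exists (i : nat) => //; rewrite mem_iota /= add0n ltn_ord.
rewrite (process_indepV XV)//; last by move=> z; exact: mB.
rewrite /positions big_map -[n in iota 0 n]subn0 -/(index_iota 0 n) big_mkord.
by apply: eq_bigr => i _; rewrite (process_lawV XV)//; exact: mB.
Qed.

Lemma integral_hidden n (F : n.-tuple V -> \bar R) :
  measurable_fun setT F -> (forall t, 0 <= F t)%E ->
  (\int[P]_w F (hidden n w) = \int[power_probability pi n]_t F t)%E.
Proof.
move=> mF F0.
pose hm : {RV P >-> n.-tuple V} :=
  HB.pack (hidden n) (isMeasurableFun.Build _ _ _ _ _ (@measurable_hidden n)).
rewrite -(ge0_integral_distribution hm mF F0).
apply: eq_measure_integral => A mA _.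
apply: (@tuple_measure_unique _ _ _ _ (distribution P hm)
   (power_probability pi n)) => // B mB.
rewrite power_rectangle//; exact: hidden_rectangle.
Qed.

Let obs := fun n w => tval (observations Xs n w).

Lemma obs_eventE n (x : n.-tuple X) (x' : int -> X) :
  (forall i : 'I_n, x' (i.+1)%:Z = tnth x i) ->
  [set w | obs n w = x] =
    \bigcap_(i in [set` positions n]) (Xs i @^-1` [set x' i]).
Proof.
move=> x'E; apply/seteqP; split => [w /val_inj xw z /mapP[i]|w h].
  rewrite mem_iota /= add0n => ilt ->.
  rewrite (x'E (Ordinal ilt)) -xw.
  by rewrite tnth_mktuple.
apply/(congr1 val)/eq_from_tnth => i; rewrite tnth_mktuple -x'E.
apply: h => /=.
by apply/mapP; exists (i : nat) => //; rewrite mem_iota /= add0n ltn_ord.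
Qed.

Lemma measurable_obs_eq n (u : seq X) : measurable [set w | obs n w = u].
Proof.
have [un|un] := eqVneq (size u) n; last first.
  rewrite (_ : [set _ | _] = set0)//; apply/seteqP; split => // w /= ow.
  by move: un; rewrite -ow size_tuple eqxx.
case: u un => [|x0 u'] un.
  rewrite (_ : [set _ | _] = setT)//; apply/seteqP; split => // w _ /=.
  by apply: size0nil; rewrite size_tuple.
set u := x0 :: u' in un *.
pose x := @Tuple n X u (introT eqP un).
pose x' (z : int) := nth x0 u (absz z).-1.
have := @obs_eventE n x x'; rewrite /= => ->; last first.
  by move=> i; rewrite (tnth_nth x0).
apply: fin_bigcap_measurable => // i _; exact: (process_measurableX XV).
Qed.

Lemma prob_obs_eq n (u : seq X) : size u = n ->
  P [set w | obs n w = u] = (lik K pi u)%:E.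
Proof.
move=> un.
(* A letter is needed to extend the word to a function on all of [int]; without letters the word is
   empty and the event is the whole space. *)
have [[x0 _]|X0] := pselect (exists x : X, True); last first.
  case: u un => [|a u] un; last by exfalso; apply: X0; exists a.
  rewrite (_ : [set _ | _] = setT) ?probability_setT ?lik_nil//.
  by apply/seteqP; split => // w _ /=; apply: size0nil; rewrite size_tuple.
pose x := @Tuple n X u (introT eqP un).
pose x' (z : int) := nth x0 u (absz z).-1.
have x'E (i : 'I_n) : x' (i.+1)%:Z = tnth x i by rewrite (tnth_nth x0).
have := @obs_eventE n x x' x'E; rewrite /= => ->.
rewrite -[X in P X]setTI (process_emission XV)//; last first.
  by rewrite -setC0; apply: sigma_algebraC; exact: sigma_algebra0.
rewrite -(integral_path_weight pi x) -integral_hidden; last 2 first.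
- by apply/measurable_EFinP; exact: measurable_path_weight.
- by move=> t; rewrite lee_fin; have /andP[] := path_weight_01 x t.
apply: eq_integral => w _; congr EFin.
rewrite /positions big_map -[n in iota 0 n]subn0 -/(index_iota 0 n) big_mkord.
by apply: eq_bigr => i _; rewrite !tnth_mktuple x'E /= addrC.
Qed.

Lemma obs_event_bigcup n (Q : seq X -> bool) :
  [set w | Q (obs n w)] =
  \bigcup_(u in [set` [seq u <- words E n | Q u]]) [set w | obs n w = u].
Proof.
apply/seteqP; split => [w /= Qw|w [u /= + ->]].
  exists (obs n w) => //=; rewrite mem_filter Qw /=; apply: mem_words => //.
  exact: size_tuple.
by rewrite mem_filter => /andP[].
Qed.

Lemma measurable_obs_event n (Q : seq X -> bool) :
  measurable [set w | Q (obs n w)].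
Proof.
rewrite obs_event_bigcup; apply: fin_bigcup_measurable => // u _.
exact: measurable_obs_eq.
Qed.

Lemma prob_obs_event n (Q : seq X -> bool) :
  P [set w | Q (obs n w)] = (\sum_(u <- words E n | Q u) lik K pi u)%:E.
Proof.
rewrite obs_event_bigcup measure_fin_bigcup//; first last.
- by move=> u _; exact: measurable_obs_eq.
- by move=> u u' _ _ [w /= [<- <-]].
- by apply/finite_seqP; exists [seq u <- words E n | Q u].
rewrite -fsbig_seq ?filter_uniq ?uniq_words// big_filter -sumEFin.
rewrite big_seq_cond [RHS]big_seq_cond; apply: eq_bigr => u /andP[uw _].
exact: prob_obs_eq (size_words uw).
Qed.

Lemma measurable_fun_obs n (h : seq X -> R) :
  measurable_fun setT (fun w => h (obs n w)).
Proof.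
move=> _ B mB; rewrite setTI.
have -> : (fun w => h (obs n w)) @^-1` B = [set w | h (obs n w) \in B].
  by apply/seteqP; split => w /=; rewrite inE.
exact: (measurable_obs_event n (fun u => h u \in B)).
Qed.

End observed_process.
End likelihood_as_integral.

(** * Limit of the log-likelihood *)

Lemma expR_nneseries_lty {R : realType} (k : R) : 0 < k ->
  (\sum_(n <oo) (2 * expR (- (k * n%:R)))%:E < +oo)%E.
Proof.
move=> k0; pose r := expR (- k); have r0 : 0 < r by exact: expR_gt0.
have r1 : 0 < 1 - r by rewrite subr_gt0 expR_lt1 oppr_lt0.
apply: (@le_lt_trans _ _ (2 / (1 - r))%:E); last exact: ltry.
apply: lime_le.
  by apply: is_cvg_nneseries => n _ _; rewrite lee_fin mulr_ge0// expR_ge0.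
apply: nearW => n; rewrite sumEFin lee_fin big_mkord -mulr_sumr.
rewrite ler_pM2l// -[leRHS]mul1r ler_pdivlMr//.
have -> : \sum_(i < n) expR (- (k * i%:R)) = \sum_(i < n) r ^+ i.
  by apply: eq_bigr => i _; rewrite -expRM_natl; congr expR; ring.
have := subrX1 r n; have : 0 <= r ^+ n by rewrite exprn_ge0// ltW.
lra.
Qed.

Section limit_loglik.
Context {R : realType} {X : choiceType} {d : measure_display}
  {V : measurableType d}.
Variables (K : X -> V -> V -> R) (nu : R).
Hypotheses (nu0 : 0 < nu) (nu1 : nu <= 1).
Hypothesis K_bounds : forall x v w, nu <= K x v w <= 1.
Hypothesis K_measurable : forall x,
  measurable_fun [set: V * V] (fun vw => K x vw.1 vw.2).
Context {dO : measure_display} {Omega : measurableType dO}.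
Variables (P : probability Omega R) (Xs : int -> Omega -> X)
  (Vs : int -> Omega -> V) (pi : probability V R) (E : seq X).
Hypothesis XV : process_law K pi P Xs Vs.
Hypotheses (uE : uniq E) (memE : forall x, x \in E).
Hypothesis sumK : forall v w, \sum_(b <- E) K b v w = 1.
Implicit Types q : probability V R.

Let Lam := - ln nu.
Let ll q (u : seq X) := ln (lik K q u).
Let lik_pos q u : 0 < lik K q u := lik_gt0 nu0 K_bounds K_measurable q u.
Let lik_dep q u s : \sum_(b <- E) lik K q (u ++ b :: s) = lik K q u * lik K q s :=
  sum_lik_cat nu0 K_bounds K_measurable q u s sumK.

Lemma ln_lik_bounds q u : - ((size u)%:R * Lam) <= ll q u <= 0.
Proof.
apply/andP; split; last first.
  by rewrite ln_le0// (lik_le1 nu0 K_bounds K_measurable).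
elim: u => [|a u ih]; first by rewrite mul0r oppr0 /ll lik_nil ln1.
have /andP[h _] := lik_cons_bounds nu0 K_bounds K_measurable q a u.
have : ln (nu * lik K q u) <= ll q (a :: u).
  by rewrite ler_ln// ?posrE ?mulr_gt0// (lt_le_trans _ h)// mulr_gt0.
rewrite lnM ?posrE// /= -natr1 => h2.
by apply: le_trans h2; move: ih; rewrite /ll /Lam; lra.
Qed.

Lemma ln_lik_near_additive q u b s : `|ll q (u ++ b :: s) - ll q u - ll q s| <= Lam.
Proof.
have /andP[h1 h2] := lik_cat_bounds nu0 K_bounds K_measurable q u b s.
have h3 : ln (nu * (lik K q u * lik K q s)) <= ll q (u ++ b :: s).
  by rewrite ler_ln// ?posrE ?mulr_gt0.
have h4 : ll q (u ++ b :: s) <= ln (lik K q u * lik K q s).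
  by rewrite ler_ln// ?posrE ?mulr_gt0.
move: h3 h4; rewrite !lnM ?posrE ?mulr_gt0// => h3 h4.
have L0 : 0 <= Lam by rewrite oppr_ge0 ln_le0.
rewrite ler_norml; move: h3 h4 L0; rewrite /Lam /ll => h3 h4 L0.
by apply/andP; split; lra.
Qed.

Definition mean_loglik q n := mean E (lik K pi) (fun u => ln (lik K q u)) n.

Lemma mean_loglik_limit q :
  exists L : R, forall n, `|mean_loglik q n - n%:R * L| <= 2 * Lam.
Proof.
apply: near_additive_limit; apply: mean_near_additive => //.
- exact: lik_nil.
- by rewrite lik_nil ln1.
- exact: ln_lik_near_additive.
Qed.

Let obs := fun n w => tval (observations Xs n w).

Lemma loglik_deviation q (t : R) : 0 < t -> exists2 k : R, 0 < k & forall n,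
  (P [set w | (n%:R * t < `|ll q (obs n w) - mean_loglik q n|)%R]
     <= (2 * expR (- (k * n%:R)))%:E)%E.
Proof.
move=> t0.
have nil0 : ll q [::] = 0 by rewrite /ll lik_nil ln1.
(* The lower tail is the upper tail of [- ll q], which is nearly additive with the same constant. *)
have add' u b s : `|- ll q (u ++ b :: s) - (- ll q u) - (- ll q s)| <= Lam.
  rewrite (_ : _ - _ - _ = - (ll q (u ++ b :: s) - ll q u - ll q s)); last ring.
  by rewrite normrN; exact: ln_lik_near_additive.
have [k1 k10 h1] := tail_exponential (lik_pos pi) (lik_nil K pi) (lik_dep pi)
  nil0 (ln_lik_near_additive q) t0.
have nil0' : - ll q [::] = 0 by rewrite nil0 oppr0.
have [k2 k20 h2] := tail_exponential (lik_pos pi) (lik_nil K pi) (lik_dep pi)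
  nil0' add' t0.
exists (Num.min k1 k2) => [|n]; first by rewrite lt_min k10.
have := prob_obs_event nu0 K_bounds K_measurable XV uE memE n
  (fun u => n%:R * t < `|ll q u - mean_loglik q n|).
rewrite /= => ->; rewrite lee_fin.
have mE : mean E (lik K pi) (fun u => - ll q u) n = - mean_loglik q n.
  by rewrite /mean /mean_loglik -sumrN; apply: eq_bigr => u _; rewrite mulrN.
move: (h1 n) (h2 n); rewrite mE -/(mean_loglik q n) => g1 g2.
have e1 : expR (- (k1 * n%:R)) <= expR (- (Num.min k1 k2 * n%:R)).
  by rewrite ler_expR lerN2 ler_wpM2r// ge_min lexx.
have e2 : expR (- (k2 * n%:R)) <= expR (- (Num.min k1 k2 * n%:R)).
  by rewrite ler_expR lerN2 ler_wpM2r// ge_min lexx orbT.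
apply: (@le_trans _ _ (\sum_(u <- words E n | mean_loglik q n + n%:R * t < ll q u)
     lik K pi u + \sum_(u <- words E n | - mean_loglik q n + n%:R * t < - ll q u)
     lik K pi u)).
  rewrite [leLHS]big_mkcond [X in _ <= X + _]big_mkcond
    [X in _ <= _ + X]big_mkcond -big_split /=.
  apply: ler_sum => u _; have l0 := ltW (lik_pos pi u).
  have c0 (b : bool) : 0 <= (if b then lik K pi u else 0) by case: b.
  case: ifPn => [|_]; last exact: addr_ge0.
  rewrite ltNge ler_norml negb_and -!ltNge => /orP[h|h].
  - rewrite [X in _ <= _ + X]ifT; first by rewrite lerDr.
    by move: h; lra.
  - rewrite ifT; first by rewrite lerDl.
    by move: h; lra.
lra.
Qed.

Let avg q n w := n%:R^-1 * ll q (obs n w).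

(** Borel-Cantelli for each threshold [1 / (k + 1)], then a countable union of null sets. Replacing
    the mean by [n * L] costs [2 * Lam], which vanishes after division by [n]. *)
Lemma loglik_cvg_ae q (L : R) :
  (forall n, `|mean_loglik q n - n%:R * L| <= 2 * Lam) ->
  {ae P, forall w, avg q n w @[n --> \oo] --> L}.
Proof.
move=> hL.
pose F k n := [set w | n%:R * k.+1%:R^-1 < `|ll q (obs n w) - mean_loglik q n|].
have mF k n : measurable (F k n).
  exact: (measurable_obs_event XV memE n
    (fun u => n%:R * k.+1%:R^-1 < `|ll q u - mean_loglik q n|)).
have F0 k : P (lim_sup_set (F k)) = 0%E.
  apply: lim_sup_set_cvg0 => //.
  have [c c0 hc] : exists2 c : R, 0 < c & forall n,
      (P (F k n) <= (2 * expR (- (c * n%:R)))%:E)%E.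
    by apply: loglik_deviation; rewrite invr_gt0.
  apply: le_lt_trans (expR_nneseries_lty c0).
  by apply: lee_nneseries => // n _; exact: hc.
rewrite /almost_everywhere.
apply: (@negligibleS _ _ _ _ (\bigcup_k lim_sup_set (F k))); last first.
  apply: negligible_bigcup => k; apply/negligibleP; last exact: F0.
  by apply: bigcapT_measurable => i; apply: bigcup_measurable => j _; exact: mF.
move=> w; apply: contra_notP => hw /=; apply/cvgrPdist_le => e e0.
have e20 : 0 < e / 2 by rewrite divr_gt0.
have [k hk] : exists k : nat, k.+1%:R^-1 <= e / 2.
  exists (Num.truncn (e / 2)^-1).
  rewrite -[leRHS]invrK lef_pV2 ?posrE ?invr_gt0//; exact/ltW/truncnS_gt.
have [N hN] : exists N, forall n, (N <= n)%N -> ~ F k n w.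
  apply: contrapT => hN; apply: hw; exists k => // N _.
  apply: contrapT => hn; apply: hN; exists N => n Nn Fn.
  by apply: hn; exists n.
near=> n.
have n0 : 0 < n%:R :> R by rewrite ltr0n; near: n; exact: nbhs_infty_gt.
have h1 : `|ll q (obs n w) - mean_loglik q n| <= n%:R * k.+1%:R^-1.
  by rewrite leNgt; apply/negP; apply: hN; near: n; exact: nbhs_infty_ge.
have h2 : 2 * Lam <= n%:R * (e / 2).
  rewrite -ler_pdivrMr//.
  near: n; exact: nbhs_infty_ger.
have h3 : n%:R * k.+1%:R^-1 <= n%:R * (e / 2) by rewrite ler_pM2l.
have := hL n.
have -> : L - avg q n w = n%:R^-1 * (n%:R * L - ll q (obs n w)).
  by rewrite /avg mulrBr mulKf ?gt_eqF.
rewrite normrM gtr0_norm ?invr_gt0// ler_pdivrMl// => h4.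
have arith (x l m c e' D : R) : - c <= l - m -> l - m <= c -> - D <= m - x ->
    m - x <= D -> c <= e' -> D <= e' -> - (e' + e') <= x - l <= e' + e'.
  by move=> *; apply/andP; split; lra.
have -> : n%:R * e = n%:R * (e / 2) + n%:R * (e / 2) by rewrite -mulrDr -splitr.
move: h1 h4; rewrite !ler_norml => /andP[a1 a2] /andP[a3 a4].
exact: arith a1 a2 a3 a4 h3 h2.
Unshelve. all: by end_near. Qed.

Lemma loglik_cvg_L1 q (L : R) : {ae P, forall w, avg q n w @[n --> \oo] --> L} ->
  (\int[P]_w (`|avg q n w - L|)%:E)%E @[n --> \oo] --> 0%E.
Proof.
move=> hL.
have L0 : 0 <= Lam by rewrite oppr_ge0 ln_le0.
have m_avg n : measurable_fun setT (avg q n).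
  exact: (measurable_fun_obs XV memE n
    (fun u => n%:R^-1 * ll q u)).
have [|||||_ h _] := @dominated_convergence _ _ _ P setT measurableT
  (fun n w => (avg q n w)%:E) (cst L%:E) (cst Lam%:E).
- by move=> n; exact/measurable_EFinP.
- exact: measurable_cst.
- apply: filterS hL => w hw _; apply: cvg_EFin; [exact: nearW | exact: hw].
- exact: finite_measure_integrable_cst.
- apply: aeW => w n _ /=; rewrite lee_fin.
  have /andP[b1 b2] := ln_lik_bounds q (obs n w).
  (* At [n = 0] the average is 0, since the inverse of 0 is 0, so the dominating constant [Lam]
     works there too. *)
  rewrite normrM; case: n b1 b2 => [|n] b1 b2.
    by rewrite invr0 normr0 mul0r.
  rewrite gtr0_norm ?invr_gt0// ler_pdivrMl ?ltr0n// ler_norml.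
  rewrite size_tuple in b1; rewrite b1 /=.
  by apply: (le_trans b2); rewrite mulr_ge0.
exact: h.
Qed.

(** Existence of a limit ensures that [xget] returns one; two almost sure limits agree because two
    events of probability 1 share a point. The rate [2 * Lam / n] of the means thus passes to
    [limit_loglik]. *)
Lemma limit_loglik_mean q n :
  `|mean_loglik q n - n%:R * limit_loglik K P Xs q| <= 2 * Lam.
Proof.
have [L hL] := mean_loglik_limit q.
have aeL := loglik_cvg_ae hL.
have avgE : avg q = fun k w => k%:R^-1 * loglik K q (observations Xs k w).
  apply/funext => k; apply/funext => w.
  by rewrite (loglikE nu0 K_bounds K_measurable).
suff -> : limit_loglik K P Xs q = L by exact: hL.
have [ae' _] : {ae P, forall w, avg q k w @[k --> \oo] --> limit_loglik K P Xs q} /\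
   (\int[P]_w (`|avg q k w - limit_loglik K P Xs q|)%:E)%E @[k --> \oo] --> 0%E.
  pose S := [set l : R | {ae P, forall w, avg q k w @[k --> \oo] --> l} /\
    (\int[P]_w (`|avg q k w - l|)%:E)%E @[k --> \oo] --> 0%E].
  have -> : limit_loglik K P Xs q = xget 0 S by rewrite /S avgE.
  apply: (xgetPex 0 (P := S)); exists L.
  by split => //; exact: loglik_cvg_L1.
have [w [h1 h2]] : exists w, avg q k w @[k --> \oo] --> limit_loglik K P Xs q /\
   avg q k w @[k --> \oo] --> L.
  apply: contrapT => hn.
  have : P.-negligible setT.
    apply: negligibleS (negligibleU ae' aeL) => w _.
    apply: contrapT => hw; apply: hn; exists w.
    by split; apply: contrapT => hw'; apply: hw; [left|right].
  move=> /(measure_negligible measurableT) h0.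
  have /eqP := etrans (esym (probability_setT P)) h0.
  by rewrite eqe oner_eq0.
exact: (cvg_unique _ h1 h2).
Qed.

End limit_loglik.

(** * Posterior concentration *)

(** The factor 2 provides the strict inequality with which a cover is extracted from the infimum. *)
Lemma covering_number_cover {d : measure_display} {V : measurableType d}
    {R : realType} (S : set (probability V R)) (e b : R) :
  (lne (covering_number S e) <= b%:E)%E ->
  exists (m : nat) (c : 'I_m -> probability V R), m%:R <= 2 * expR b /\
    forall p, S p -> exists i, tv_dist p (c i) <= e.
Proof.
move=> h.
have c0 : (0 <= covering_number S e)%E.
  rewrite leNgt; apply/negP => /ereal_inf_lt[_ [m _ <-]].
  by rewrite lte_fin ltNge ler0n.
have : (covering_number S e < (2 * expR b)%:E)%E.
  rewrite -(lneK (x := covering_number S e)); last by rewrite in_itv /= c0 leey.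
  apply: (@le_lt_trans _ _ (expeR b%:E)); first by rewrite lee_expeR.
  by rewrite /= lte_fin; have := expR_gt0 b; lra.
move=> /ereal_inf_lt[_ [m [c hc] <-]]; rewrite lte_fin => mb.
by exists m, c; split => //; exact: ltW.
Qed.

(* Jensen's inequality for [x |-> x^-1] on the restriction of [mu] to [B]. *)
Lemma harmonic_mean_le {d : measure_display} {T : measurableType d}
    {R : realType} (mu : probability T R) (B : set T) (f : T -> R) :
  measurable B -> bounded_measurable f ->
  bounded_measurable (fun x => (f x)^-1) -> (forall x, 0 < f x) ->
  0 < \int[mu]_x f x ->
  fine (mu B) ^+ 2 <= (\int[mu]_x f x) * \int[mu]_x (\1_B x * (f x)^-1).
Proof.
move=> mB bf bfV f0; set I := \int[mu]_x f x => I0.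
have bB := bounded_measurable_indic (R := R) mB.
have bJ : bounded_measurable (fun x => \1_B x * (f x)^-1).
  exact: bounded_measurableM.
have bc (c : R) : bounded_measurable (fun _ : T => c).
  exact: bounded_measurable_cst.
set b := fine (mu B); set J := \int[mu]_x _.
(* The tangent inequality [1 / y >= 2 * c - c ^+ 2 * y], integrated over [B]; the best choice is
   [c = b / I]. *)
have key (c : R) : 0 < c -> 2 * c * b - c ^+ 2 * I <= J.
  move=> c0; rewrite /b -(prob_Rintegral_indic mu mB) /I -!prob_RintegralZl//.
  rewrite -prob_RintegralB; try exact: bounded_measurableM.
  apply: prob_le_Rintegral => //.
    by apply: bounded_measurableB; exact: bounded_measurableM.
  move=> x; have fx := f0 x; rewrite indicE; case: (x \in B) => /=.
    rewrite !mulr1 mul1r -subr_ge0.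
    have -> : (f x)^-1 - (2 * c - c ^+ 2 * f x) = (c * f x - 1) ^+ 2 / f x.
      by field; rewrite gt_eqF.
    by rewrite divr_ge0 ?sqr_ge0// ltW.
  by rewrite mulr0 mul0r sub0r oppr_le0 mulr_ge0 ?sqr_ge0// ltW.
have b0 : 0 <= b by rewrite fine_ge0.
have [b0'|b0'] := leP b 0.
  have -> : b = 0 by apply/eqP; rewrite eq_le b0' b0.
  rewrite expr0n /= mulr_ge0 ?(ltW I0)//; apply: Rintegral_ge0 => x _.
  by rewrite mulr_ge0 ?invr_ge0 ?(ltW (f0 x)).
have := key (b / I) (divr_gt0 b0' I0).
have -> : 2 * (b / I) * b - (b / I) ^+ 2 * I = b ^+ 2 / I.
  by field; rewrite gt_eqF.
by rewrite ler_pdivrMr// mulrC.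
Qed.

Section posterior_tail.
Context {R : realType} {X : choiceType} {d : measure_display}
  {V : measurableType d}.
Variables (K : X -> V -> V -> R) (nu : R).
Hypotheses (nu0 : 0 < nu) (nu1 : nu < 1).
Hypothesis K_bounds : forall x v w, nu <= K x v w <= 1.
Hypothesis K_measurable : forall x,
  measurable_fun [set: V * V] (fun vw => K x vw.1 vw.2).
Variable E : seq X.
Hypothesis sumK : forall v w, \sum_(b <- E) K b v w = 1.
Context {dP : measure_display} {Pi : measurableType dP}.
Variables (law : Pi -> probability V R) (mu : probability Pi R)
  (pistar : probability V R).
Hypothesis lik_measurable : forall u,
  measurable_fun setT (fun p : Pi => lik K (law p) u).
Implicit Types (q : probability V R) (A B S : set Pi).

Let nuW : nu <= 1 := ltW nu1.
Let Lam := - ln nu.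
Let Cp := predictive_const nu.
Let ps := lik K pistar.
Let lik_pos q u : 0 < lik K q u := lik_gt0 nu0 K_bounds K_measurable q u.
Let lik_dep q u s : \sum_(b <- E) lik K q (u ++ b :: s) = lik K q u * lik K q s :=
  sum_lik_cat nu0 K_bounds K_measurable q u s sumK.
Let lik_total q n : \sum_(u <- words E n) lik K q u = 1 :=
  sum_words_total (lik_nil K q) (lik_dep q) n.
Let mean_ll q n := mean_loglik K pistar E q n.

Let bounded_lik u : bounded_measurable (fun p : Pi => lik K (law p) u).
Proof.
apply: (itv_bounded_measurable (a := 0) (b := 1)) => // p.
by rewrite (ltW (lik_pos _ _)) (lik_le1 nu0 K_bounds K_measurable).
Qed.

Let bounded_likV u : bounded_measurable (fun p : Pi => (lik K (law p) u)^-1).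
Proof.
have -> : (fun p : Pi => (lik K (law p) u)^-1) =
    (fun p => expR (- ln (lik K (law p) u))).
  by apply/funext => p; rewrite expRN lnK// posrE.
apply: (itv_bounded_measurable (a := 0) (b := expR ((size u)%:R * Lam))).
  apply: measurableT_comp; first exact: measurable_expR.
  by apply: measurable_funN; apply: measurableT_comp.
move=> p; rewrite expR_ge0 ler_expR /=.
have /andP[h _] := ln_lik_bounds nu0 K_bounds K_measurable (law p) u.
by rewrite lerNl.
Qed.

Definition evidence u := \int[mu]_p lik K (law p) u.
Definition joint A u := \int[mu]_p (\1_A p * lik K (law p) u).

Lemma evidence_gt0 u : 0 < evidence u.
Proof.
apply: (@lt_le_trans _ _ (expR (- ((size u)%:R * Lam)))); first exact: expR_gt0.
rewrite -(prob_Rintegral_cst mu (expR _)); apply: prob_le_Rintegral => //.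
  exact: bounded_measurable_cst.
move=> p; have /andP[h _] := ln_lik_bounds nu0 K_bounds K_measurable (law p) u.
by rewrite -[leRHS]lnK ?posrE// ler_expR.
Qed.

Lemma chi_square_lik q n :
  \sum_(u <- words E n) ps u ^+ 2 / lik K q u <=
  expR (n%:R * (Cp * tv_dist pistar q) ^+ 2).
Proof.
have e0 : 0 <= Cp * tv_dist pistar q.
  by rewrite mulr_ge0 ?tv_dist_ge0// (predictive_const_ge0 nu0).
have sum1 r s : \sum_(a <- E) lik K r (a :: s) = lik K r s.
  exact: (sum_cons (lik_nil K r) (lik_dep r)).
have pq r r' a s : lik K r (a :: s) * lik K r' s <=
    (1 + Cp * tv_dist r r') * (lik K r s * lik K r' (a :: s)).
  exact: (lik_predictive nu0 nuW K_bounds K_measurable).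
have qp a s : lik K q (a :: s) * ps s <=
    (1 + Cp * tv_dist pistar q) * (lik K q s * ps (a :: s)).
  by rewrite tv_distC; exact: pq.
have := chi_square_words (lik_pos pistar) (lik_pos q) (sum1 pistar) (sum1 q)
  e0 (pq pistar q) qp n [::].
under eq_bigr do rewrite cats0.
rewrite !lik_nil expr1n divr1 mulr1 => h; apply: (le_trans h).
rewrite expRM_natl; apply: lerXn2r; rewrite ?nnegrE ?expR_ge0//.
  by rewrite addr_ge0// sqr_ge0.
exact: expR_ge1Dx.
Qed.

Lemma evidence_tail n (t b a : R) :
  let B := [set p : Pi | tv_dist (law p) pistar <= t] in
  measurable B -> 0 < b -> b <= fine (mu B) ->
  \sum_(u <- words E n | expR a * evidence u < ps u) ps u <=
  expR (- a) * (b^-1 * expR (n%:R * (Cp * t) ^+ 2)).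
Proof.
move=> B mB b0 bB.
have beta0 : 0 < fine (mu B) by exact: lt_le_trans bB.
have bI := bounded_measurable_indic (R := R) mB.
have bc (c : R) : bounded_measurable (fun _ : Pi => c).
  exact: bounded_measurable_cst.
have b1 u : bounded_measurable (fun p => \1_B p * (lik K (law p) u)^-1).
  exact: bounded_measurableM.
apply: (@le_trans _ _ (expR (- a) * \sum_(u <- words E n) ps u ^+ 2 / evidence u)).
  rewrite big_mkcond mulr_sumr; apply: ler_sum => u _.
  have e0 := evidence_gt0 u.
  case: ifPn => [h|_]; last first.
    by rewrite mulr_ge0 ?expR_ge0// divr_ge0 ?sqr_ge0// ltW.
  rewrite expRN ler_pdivlMl ?expR_gt0// ler_pdivlMr// mulrAC expr2.
  by rewrite ler_wpM2r ?(ltW (lik_pos _ _))// ltW.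
rewrite ler_pM2l ?expR_gt0//.
(* The harmonic mean bound moves the inverse inside the prior integral, so that after exchanging sum
   and integral the inner sum is one chi-square bound for each parameter of [B]. *)
apply: (@le_trans _ _ (\sum_(u <- words E n)
    (fine (mu B) ^+ 2)^-1 * (ps u ^+ 2 * \int[mu]_p (\1_B p * (lik K (law p) u)^-1)))).
  apply: ler_sum => u _; have e0 := evidence_gt0 u.
  rewrite mulrCA ler_wpM2l ?sqr_ge0// ler_pdivlMl ?exprn_gt0// ler_pdivrMr// mulrC.
  exact: harmonic_mean_le.
rewrite -mulr_sumr.
have -> : \sum_(u <- words E n) ps u ^+ 2 * \int[mu]_p (\1_B p * (lik K (law p) u)^-1)
   = \int[mu]_p (\sum_(u <- words E n) ps u ^+ 2 * (\1_B p * (lik K (law p) u)^-1)).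
  rewrite prob_Rintegral_sum; last by move=> u _; exact: bounded_measurableM.
  by apply: eq_bigr => u _; rewrite prob_RintegralZl.
have h : \int[mu]_p (\sum_(u <- words E n) ps u ^+ 2 * (\1_B p * (lik K (law p) u)^-1))
   <= expR (n%:R * (Cp * t) ^+ 2) * fine (mu B).
  rewrite -(prob_Rintegral_indic mu mB) -prob_RintegralZl//.
  apply: prob_le_Rintegral.
  - by apply: bounded_measurable_sum => u _; exact: bounded_measurableM.
  - exact: bounded_measurableM.
  move=> p; rewrite indicE; case: (boolP (p \in B)) => [pB|_] /=; last first.
    by rewrite mulr0 big1// => u _; rewrite mul0r mulr0.
  rewrite mulr1; under eq_bigr do rewrite mul1r.
  apply: (le_trans (chi_square_lik (law p) n)).
  have Cp0 : 0 <= Cp by exact: predictive_const_ge0.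
  have pt : tv_dist pistar (law p) <= t by rewrite tv_distC; move: pB; rewrite inE.
  have t0 : 0 <= t by exact: le_trans (tv_dist_ge0 _ _) pt.
  rewrite ler_expR ler_wpM2l//; apply: lerXn2r; rewrite ?nnegrE ?mulr_ge0 ?tv_dist_ge0//.
  by rewrite ler_wpM2l.
apply: (@le_trans _ _ ((fine (mu B) ^+ 2)^-1 *
    (expR (n%:R * (Cp * t) ^+ 2) * fine (mu B)))).
  by rewrite ler_wpM2l// invr_ge0 sqr_ge0.
have -> : (fine (mu B) ^+ 2)^-1 * (expR (n%:R * (Cp * t) ^+ 2) * fine (mu B)) =
   (fine (mu B))^-1 * expR (n%:R * (Cp * t) ^+ 2).
  by field; rewrite gt_eqF.
by rewrite ler_wpM2r ?expR_ge0// lef_pV2.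
Qed.

(** Markov's inequality for [joint S u / ps u], whose mean under the true law is [mu S] because each
    likelihood sums to 1 over words. *)
Lemma sieve_tail n S (k : R) : measurable S -> 0 < k ->
  \sum_(u <- words E n | k * ps u < joint S u) ps u <= k^-1 * fine (mu S).
Proof.
move=> mS k0; have bS := bounded_measurable_indic (R := R) mS.
have b1 u : bounded_measurable (fun p => \1_S p * lik K (law p) u).
  exact: bounded_measurableM.
have j0 u : 0 <= joint S u.
  apply: Rintegral_ge0 => p _; by rewrite mulr_ge0 ?(ltW (lik_pos _ _)).
apply: (@le_trans _ _ (k^-1 * \sum_(u <- words E n) joint S u)).
  rewrite big_mkcond mulr_sumr; apply: ler_sum => u _.
  case: ifPn => [h|_]; last by rewrite mulr_ge0// invr_ge0 ltW.
  by rewrite ler_pdivlMl// ltW.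
rewrite ler_pM2l ?invr_gt0// -prob_Rintegral_sum; last by move=> u _; exact: b1.
rewrite -(prob_Rintegral_indic mu mS) le_eqVlt; apply/orP; left; apply/eqP.
by apply: eq_Rintegral => p _; rewrite -mulr_sumr lik_total mulr1.
Qed.

(** The log-likelihood ratio is nearly additive with constant [2 * Lam]. The choice of [lam] makes
    the quadratic term [2 * e ^+ 2], and the constant 32 makes the linear one [4 * e ^+ 2]; the
    difference is twice the entropy exponent [e ^+ 2] of the cover. *)
Lemma centre_tail n q (e : R) : 0 <= e -> e <= 1 / 2 ->
  \sum_(u <- words E n |
     mean_ll q n - mean_ll pistar n + n%:R * (32 * Lam * e)
       < ln (lik K q u) - ln (ps u)) ps u
  <= expR (- (2 * n%:R * e ^+ 2)).
Proof.
move=> e0 e2; have L0 : 0 < Lam by rewrite oppr_gt0 ln_lt0// nu0.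
pose f u := ln (lik K q u) - ln (ps u).
have f_nil : f [::] = 0 by rewrite /f /ps !lik_nil subrr.
have f_add u b s : `|f (u ++ b :: s) - f u - f s| <= 2 * Lam.
  have h1 := ln_lik_near_additive nu0 nuW K_bounds K_measurable q u b s.
  have h2 := ln_lik_near_additive nu0 nuW K_bounds K_measurable pistar u b s.
  move: h1 h2; rewrite /f /ps !ler_norml -/Lam => /andP[? ?] /andP[? ?].
  by apply/andP; split; lra.
pose lam := e / (8 * Lam).
have lam0 : 0 <= lam by rewrite divr_ge0// mulr_ge0// ltW.
have lamE : lam * (4 * (2 * Lam)) = e.
  by rewrite /lam; field; rewrite gt_eqF.
have := tail_bound (lik_pos pistar) (lik_nil K pistar) (lik_dep pistar) f_nil f_add
  (32 * Lam * e) n lam0.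
rewrite lamE => /(_ e2).
have -> : mean E (lik K pistar) f n = mean_ll q n - mean_ll pistar n.
  rewrite /mean_ll /mean_loglik /mean -sumrB; apply: eq_bigr => u _.
  by rewrite /f mulrBr.
move=> h; apply: (le_trans h); rewrite ler_expR.
have -> : lam * (32 * Lam * e) = 4 * e ^+ 2.
  by rewrite /lam; field; rewrite gt_eqF.
by rewrite le_eqVlt; apply/orP; left; apply/eqP; ring.
Qed.

Lemma cover_tail n (m : nat) (c : 'I_m -> probability V R) (e : R) :
  0 <= e -> e <= 1 / 2 ->
  \sum_(u <- words E n | [exists i,
     mean_ll (c i) n - mean_ll pistar n + n%:R * (32 * Lam * e)
       < ln (lik K (c i) u) - ln (ps u)]) ps u
  <= m%:R * expR (- (2 * n%:R * e ^+ 2)).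
Proof.
move=> e0 e2.
apply: (@le_trans _ _ (\sum_(i < m) \sum_(u <- words E n |
     mean_ll (c i) n - mean_ll pistar n + n%:R * (32 * Lam * e)
       < ln (lik K (c i) u) - ln (ps u)) ps u)); last first.
  have -> : m%:R * expR (- (2 * n%:R * e ^+ 2)) =
      \sum_(i < m) expR (- (2 * n%:R * e ^+ 2)).
    by rewrite sumr_const card_ord mulr_natl.
  apply: ler_sum => i _.
  exact: centre_tail.
under [leRHS]eq_bigr do rewrite big_mkcond /=.
rewrite exchange_big /= big_mkcond; apply: ler_sum => u _.
have c0 (b : bool) : 0 <= (if b then ps u else 0) by case: b => //; exact/ltW/lik_pos.
case: ifPn => [/existsP[i hi]|_]; last exact: sumr_ge0.
by rewrite (bigD1 i)//= hi lerDl sumr_ge0.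
Qed.

(* [L q] stands for the limit of [mean_ll q n / n]. *)
Lemma posterior_event_bound n (L : probability V R -> R) A S
    (m : nat) (c : 'I_m -> probability V R) (e cbar a alpha : R) u :
  (forall q, `|mean_ll q n - n%:R * L q| <= 2 * Lam) ->
  measurable A -> measurable S -> 0 < alpha -> size u = n ->
  (forall p, S p -> exists i, tv_dist (law p) (c i) <= e) ->
  (forall p, A p -> cbar * e < L pistar - L (law p)) ->
  expR (4 * Lam - n%:R * ((cbar - 2 * Cp - 32 * Lam) * e)) <=
    alpha * expR (- a) / 2 ->
  alpha < joint A u / evidence u ->
  [|| expR a * evidence u < ps u,
      alpha * expR (- a) / 2 * ps u < joint (~` S) u |
      [exists i, mean_ll (c i) n - mean_ll pistar n + n%:R * (32 * Lam * e)
         < ln (lik K (c i) u) - ln (ps u)]].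
Proof.
move=> hL mA mS al0 un Sc hA hM; apply: contraTT.
rewrite !negb_or -!leNgt => /and3P[g1 g2 g3].
have ev0 := evidence_gt0 u; have ps0 := lik_pos pistar u.
have mSC : measurable (~` S) by exact: measurableC.
have Cp0 : 0 <= Cp by exact: predictive_const_ge0.
have bd B : measurable B -> bounded_measurable (fun p => \1_B p * lik K (law p) u).
  by move=> mB; apply: bounded_measurableM => //; exact: bounded_measurable_indic.
rewrite ler_pdivrMr//.
have g1' : ps u * expR (- a) <= evidence u.
  by rewrite expRN ler_pdivrMr ?expR_gt0// mulrC.
apply: (@le_trans _ _ (alpha * (ps u * expR (- a)))); last by rewrite ler_pM2l.
(* Half of the allowed mass goes to the complement of the sieve, half to the part of [A] inside
   it. *)
have -> : alpha * (ps u * expR (- a)) =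
   alpha * expR (- a) / 2 * ps u + alpha * expR (- a) / 2 * ps u by lra.
set kap := alpha * expR (- a) / 2 in hM g2 *.
have split : joint A u <= joint (A `&` S) u + joint (~` S) u.
  rewrite -prob_RintegralD; last 2 first.
  - by apply: bd; exact: measurableI.
  - exact: bd.
  apply: prob_le_Rintegral; first exact: bd.
    by apply: bounded_measurableD; apply: bd => //; exact: measurableI.
  move=> p; rewrite -mulrDl ler_wpM2r ?(ltW (lik_pos _ _))//.
  rewrite !indicE in_setI in_setC.
  by case: (p \in A); case: (p \in S); rewrite /= ?addr0 ?add0r.
apply: (le_trans split); apply: lerD => //.
rewrite -(prob_Rintegral_cst mu (kap * ps u)); apply: prob_le_Rintegral.
- by apply: bd; exact: measurableI.
- exact: bounded_measurable_cst.
move=> p; have kap0 : 0 <= kap.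
  by rewrite divr_ge0// mulr_ge0 ?expR_ge0// ltW.
rewrite indicE; case: (boolP (p \in A `&` S)) => [|_]; last first.
  by rewrite mul0r mulr_ge0// ltW.
rewrite inE mul1r => -[Ap Sp].
have [i tvi] := Sc p Sp.
have := g3; rewrite negb_exists => /forallP/(_ i); rewrite -leNgt => g3i.
have e0 : 0 <= e by exact: le_trans (tv_dist_ge0 _ _) tvi.
(* Moving from [law p] to its centre is done twice, at the observed word and in the mean under the
   true law: this is the [2 * Cp]. *)
have lip q q' w : size w = n -> tv_dist q q' <= e ->
    ln (lik K q w) <= ln (lik K q' w) + n%:R * (Cp * e).
  move=> wn qq.
  apply: (le_trans (ln_lik_lipschitz nu0 nuW K_bounds K_measurable q q' w)).
  by rewrite lerD2l wn ler_wpM2l// ler_wpM2l.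
have l1 := lip _ _ u un tvi.
have l2 : mean_ll (c i) n <= mean_ll (law p) n + n%:R * (Cp * e).
  have -> : mean_ll (law p) n + n%:R * (Cp * e) =
     \sum_(w <- words E n) ps w * (ln (lik K (law p) w) + n%:R * (Cp * e)).
    under eq_bigr do rewrite mulrDr.
    by rewrite big_split /= -mulr_suml lik_total mul1r.
  rewrite /mean_ll /mean_loglik /mean big_seq [leRHS]big_seq.
  apply: ler_sum => w wn; rewrite ler_wpM2l ?(ltW (lik_pos _ _))//.
  by apply: lip; [exact: (size_words wn) | rewrite tv_distC].
have n0 : 0 <= n%:R :> R by exact: ler0n.
have hr : n%:R * (cbar * e) <= n%:R * (L pistar - L (law p)).
  by rewrite ler_wpM2l// ltW// hA.
have h1 := hL pistar; have h2 := hL (law p).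
move: h1 h2; rewrite !ler_norml => /andP[m1 m2] /andP[m3 m4].
(* Passing from means to limits, for [pistar] and for [law p], costs [2 * Lam] each; [32 * Lam] is
   the width allowed to the deviation at the centre. *)
have fin : ln (lik K (law p) u) <=
   4 * Lam - n%:R * ((cbar - 2 * Cp - 32 * Lam) * e) + ln (ps u).
  move: l1 l2 g3i hr m1 m2 m3 m4; lra.
have : lik K (law p) u <=
    expR (4 * Lam - n%:R * ((cbar - 2 * Cp - 32 * Lam) * e)) * ps u.
  rewrite -[leLHS]lnK ?posrE// -[X in _ <= _ * X]lnK ?posrE// -expRD ler_expR.
  exact: fin.
by move=> h; apply: (le_trans h); rewrite ler_wpM2r// ltW.
Qed.

Lemma posterior_sum_bound n (L : probability V R -> R) A S
    (m : nat) (c : 'I_m -> probability V R) (e cbar a alpha t b : R) :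
  let B := [set p : Pi | tv_dist (law p) pistar <= t] in
  (forall q, `|mean_ll q n - n%:R * L q| <= 2 * Lam) ->
  measurable A -> measurable S -> 0 < alpha ->
  (forall p, S p -> exists i, tv_dist (law p) (c i) <= e) ->
  (forall p, A p -> cbar * e < L pistar - L (law p)) ->
  expR (4 * Lam - n%:R * ((cbar - 2 * Cp - 32 * Lam) * e)) <=
    alpha * expR (- a) / 2 ->
  0 <= e -> e <= 1 / 2 -> measurable B -> 0 < b -> b <= fine (mu B) ->
  \sum_(u <- words E n | alpha < joint A u / evidence u) ps u <=
    expR (- a) * (b^-1 * expR (n%:R * (Cp * t) ^+ 2))
    + (alpha * expR (- a) / 2)^-1 * fine (mu (~` S))
    + m%:R * expR (- (2 * n%:R * e ^+ 2)).
Proof.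
move=> B hL mA mS al0 Sc hA hM e0 e2 mB b0 bB.
have kap0 : 0 < alpha * expR (- a) / 2 by rewrite divr_gt0// mulr_gt0// expR_gt0.
have t1 := evidence_tail n a mB b0 bB.
have t2 := sieve_tail n (measurableC mS) kap0.
have t3 := cover_tail n c e0 e2.
apply: le_trans (lerD (lerD t1 t2) t3).
rewrite [leLHS]big_mkcond [X in _ <= X + _ + _]big_mkcond
  [X in _ <= _ + X + _]big_mkcond [X in _ <= _ + _ + X]big_mkcond -!big_split /=.
rewrite big_seq [leRHS]big_seq; apply: ler_sum => u uw.
have c0 (x : bool) : 0 <= (if x then ps u else 0) by case: x => //; exact/ltW/lik_pos.
case: ifPn => [h|_]; last by rewrite !addr_ge0.
have := posterior_event_bound hL mA mS al0 (size_words uw) Sc hA hM h.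
case/or3P => ->; rewrite -?addrA ?lerDl ?addr_ge0//.
- by rewrite addrCA lerDl addr_ge0.
- by rewrite addrA lerDr addr_ge0.
Qed.

(** A pointwise limit of measurable functions, needed because the set of parameters of large risk
    must be measurable. *)
Lemma measurable_mean_limit (L : probability V R -> R) :
  (forall q n, `|mean_ll q n - n%:R * L q| <= 2 * Lam) ->
  measurable_fun setT (fun p : Pi => L (law p)).
Proof.
move=> hL; have L0 : 0 < Lam by rewrite oppr_gt0 ln_lt0// nu0.
apply: (measurable_fun_cvg (h := fun n p => n.+1%:R^-1 * mean_ll (law p) n.+1)).
  move=> n; apply: measurable_funM => //.
  suff [] : bounded_measurable (fun p : Pi => mean_ll (law p) n.+1) by [].
  apply: bounded_measurable_sum => u _.
  apply: bounded_measurableM; first exact: bounded_measurable_cst.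
  apply: (itv_bounded_measurable (a := - ((size u)%:R * Lam)) (b := 0)).
    by apply: measurableT_comp.
  by move=> p; exact: (ln_lik_bounds nu0 K_bounds K_measurable).
move=> p _; apply/cvgrPdist_le => e e0; near=> n.
have n0 : 0 < n.+1%:R :> R by rewrite ltr0n.
have -> : L (law p) - n.+1%:R^-1 * mean_ll (law p) n.+1 =
    - (n.+1%:R^-1 * (mean_ll (law p) n.+1 - n.+1%:R * L (law p))).
  by field; rewrite gt_eqF.
rewrite normrN normrM gtr0_norm ?invr_gt0// ler_pdivrMl//.
apply: (le_trans (hL _ _)); rewrite -ler_pdivrMr//.
apply: (@le_trans _ _ n%:R); last by rewrite ler_nat.
near: n; exact: nbhs_infty_ger.
Unshelve. all: by end_near. Qed.

(** The case [n = 1] is enough. It yields the crude bound [5 * Lam] on the risk, hence on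
    [c_bar * eps n] whenever some parameter exceeds that threshold. *)
Lemma mean_limit_bounds (L : probability V R -> R) q :
  (forall q n, `|mean_ll q n - n%:R * L q| <= 2 * Lam) ->
  - (3 * Lam) <= L q <= 2 * Lam.
Proof.
move=> hL.
have m1 : - Lam <= mean_ll q 1 <= 0.
  have b u : u \in words E 1 -> - Lam <= ln (lik K q u) <= 0.
    move=> /size_words u1.
    by have := ln_lik_bounds nu0 K_bounds K_measurable q u; rewrite u1 mul1r.
  have -> : - Lam = \sum_(u <- words E 1) ps u * (- Lam).
    by rewrite -mulr_suml lik_total mul1r.
  apply/andP; split; rewrite /mean_ll /mean_loglik /mean big_seq ?[leRHS]big_seq.
    apply: ler_sum => u /b/andP[h _]; rewrite ler_wpM2l// ltW//; exact: lik_pos.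
  apply: sumr_le0 => u /b/andP[_ h]; rewrite mulr_ge0_le0// ltW//; exact: lik_pos.
have := hL q 1%N; rewrite mul1r ler_norml; move: m1 => /andP[? ?] /andP[? ?].
by apply/andP; split; lra.
Qed.

End posterior_tail.

(** * Choice of the exponents and conclusion *)

Lemma nepst2_cvg {R : realType} (epst : nat -> R) :
  (forall n, (0 < n)%N -> 0 < epst n) ->
  (fun n => ((n%:R * epst n ^+ 2)^-1 * ln (epst n) ^+ 2)%R : R^o)
    =o_\oo (fun=> 1%R : R^o) ->
  forall M : R, \forall n \near \oo, M <= n%:R * epst n ^+ 2.
Proof.
move=> e0 /eqoP h M; pose M' := `|M| + 1.
have M0 : 0 < M' by rewrite ltr_pwDr.
have MM : M <= M' by rewrite (le_trans (ler_norm M))// lerDl.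
pose l2 := ln (2 : R); have l20 : 0 < l2 by rewrite ln_gt0// ltr1n.
have eta0 : 0 < l2 ^+ 2 / M' by rewrite divr_gt0// exprn_gt0.
have {}h := h _ eta0.
near=> n.
have n0 : (0 < n)%N by near: n; exact: nbhs_infty_gt.
have en := e0 n n0.
have n0' : 0 < n%:R :> R by rewrite ltr0n.
have Z0 : 0 < n%:R * epst n ^+ 2 by rewrite mulr_gt0// exprn_gt0.
(* If [epst n] is at least [1 / 2], then [n / 4] is a lower bound. Otherwise the squared logarithm
   is at least the square of [ln 2], and the little-o with constant [l2 ^+ 2 / M'] gives the
   claim. *)
apply: (le_trans MM); have [e2|e2] := leP (2^-1) (epst n).
  apply: (@le_trans _ _ (n%:R * 2^-1 ^+ 2)).
    rewrite -ler_pdivrMr ?exprn_gt0 ?invr_gt0//.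
    near: n; exact: nbhs_infty_ger.
  by rewrite ler_pM2l//; apply: lerXn2r; rewrite ?nnegrE ?invr_ge0 ?(ltW en).
have hn : `|(n%:R * epst n ^+ 2)^-1 * ln (epst n) ^+ 2| <= l2 ^+ 2 / M' * `|1 : R|.
  by near: n; exact: h.
move: hn; rewrite normr1 mulr1 ger0_norm; last first.
  by rewrite mulr_ge0 ?sqr_ge0// invr_ge0 ltW.
rewrite ler_pdivrMl// mulrA ler_pdivlMr// => hn.
have lle : l2 ^+ 2 <= ln (epst n) ^+ 2.
  rewrite -[leRHS]sqrrN; apply: lerXn2r; rewrite ?nnegrE ?ltW//.
    by rewrite oppr_gt0 ln_lt0// en /= (lt_le_trans e2)// invf_le1// ler1n.
  have : ln (epst n) < ln (2^-1 : R) by rewrite ltr_ln ?posrE// invr_gt0.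
  by rewrite lnV ?posrE// /l2; lra.
have : l2 ^+ 2 * M' <= n%:R * epst n ^+ 2 * l2 ^+ 2.
  by apply: le_trans hn; rewrite ler_pM2r.
by rewrite mulrC ler_pM2r// exprn_gt0.
Unshelve. all: by end_near. Qed.

(** In [a], the term [c1] pays for the prior mass of the ball, [Cp ^+ 2] for the chi-square bound,
    and 1 leaves a factor [expR (- Z)]. What remains of the sieve exponent [c2] after paying for
    [alpha] and for [a] is [delta]. *)
Lemma exponential_bookkeeping {R : realType}
    (Cp Lam c1 c2 ca cbar k n Z e et alpha : R) :
  let a := (c1 + Cp ^+ 2 + 1) * Z in
  let delta := c2 - ca - c1 - (Cp ^+ 2 + 1) in
  0 <= Cp -> 0 < Lam -> 0 < c2 -> 0 < k -> 0 <= n -> 0 < e -> 0 < et -> et <= e ->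
  Z = n * et ^+ 2 -> 0 < alpha ->
  2 * (1 + Num.sqrt 2) * (1 + Num.sqrt c2) * (Cp ^+ 2 + 2 * Cp + 32 * Lam + 2)
    < cbar ->
  cbar * e <= 5 * Lam -> alpha^-1 <= k * expR (ca * Z) ->
  4 * Lam + 2 * k <= delta * Z ->
  e <= 1 / 2 /\
  expR (4 * Lam - n * ((cbar - 2 * Cp - 32 * Lam) * e)) <=
    alpha * expR (- a) / 2.
Proof.
move=> a delta Cp0 L0 c20 k0 n0 e0 et0 ete ZE al0 hc ce alk hZ.
set q : R := Num.sqrt c2 in hc *.
have q0 : 0 <= q by exact: sqrtr_ge0.
have q2 : q ^+ 2 = c2 by rewrite sqr_sqrtr// ltW.
have s2 : 1 <= Num.sqrt (2 : R).
  by rewrite -[leLHS]sqrtr1 ler_wsqrtr// ler1n.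
set cn := Cp ^+ 2 + 2 * Cp + 32 * Lam + 2 in hc.
have cn0 : 0 < cn.
  by rewrite /cn; have := sqr_ge0 Cp; move: Cp0 L0; lra.
have hc4 : 4 * (1 + q) * cn < cbar.
  apply: le_lt_trans hc; rewrite ler_pM2r// ler_wpM2r//; last by lra.
  by rewrite addr_ge0.
have ec : 4 * (1 + q) * cn * e <= 5 * Lam.
  by apply: le_trans ce; rewrite ler_pM2r// ltW.
have cnL : 32 * Lam <= cn by rewrite /cn; have := sqr_ge0 Cp; move: Cp0 L0; lra.
(* The denominator is [4 * 32]: [cbar] exceeds [4 * (1 + q) * cn], [cn] is at least [32 * Lam], and
   [cbar * e] is at most [5 * Lam]. *)
have qe : (1 + q) * e <= 5 / 128.
  have : 4 * ((1 + q) * e) * (32 * Lam) <= 4 * ((1 + q) * e) * cn.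
    by rewrite ler_wpM2l// !mulr_ge0 ?addr_ge0// ltW.
  move=> h; have : (1 + q) * e * Lam <= 5 / 128 * Lam by lra.
  by rewrite ler_pM2r.
have qe0 : 0 <= q * e by rewrite mulr_ge0// ltW.
split; first by lra.
(* Since [q * e <= 1], one has [c2 * et ^+ 2 <= (q * e) ^+ 2 <= q * e], and the margin in [cbar] is
   at least [q]. *)
have M1 : c2 * Z <= n * ((cbar - 2 * Cp - 32 * Lam) * e).
  rewrite ZE mulrCA ler_wpM2l//.
  apply: (@le_trans _ _ (q * e)).
    have h1 : c2 * et ^+ 2 <= (q * e) ^+ 2.
      rewrite exprMn q2 ler_wpM2l ?(ltW c20)//.
      by apply: lerXn2r; rewrite ?nnegrE ?(ltW e0) ?(ltW et0).
    apply: (le_trans h1); rewrite expr2 ler_piMl//; lra.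
  rewrite ler_pM2r//.
  have h : q <= 2 * (1 + q) * cn.
    have cn2 : 2 <= cn by rewrite /cn; have := sqr_ge0 Cp; move: Cp0 L0; lra.
    have : 0 <= (1 + q) * (cn - 2) by apply: mulr_ge0; [exact: addr_ge0|lra].
    lra.
  have : 0 <= q * cn by rewrite mulr_ge0// ltW.
  have := sqr_ge0 Cp; rewrite /cn in hc4 h *; lra.
apply: (@le_trans _ _ (expR (4 * Lam - c2 * Z))).
  by rewrite ler_expR lerB.
have al : (k * expR (ca * Z))^-1 <= alpha.
  by rewrite -[leRHS]invrK lef_pV2// posrE ?invr_gt0// mulr_gt0// expR_gt0.
apply: (@le_trans _ _ ((k * expR (ca * Z))^-1 * expR (- a) / 2)); last first.
  by rewrite ler_pM2r// ler_wpM2r ?expR_ge0.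
have -> : (k * expR (ca * Z))^-1 * expR (- a) / 2 =
   expR (- (ca * Z) - a) / (2 * k).
  by rewrite expRD !expRN; field; rewrite !gt_eqF ?expR_gt0.
rewrite ler_pdivlMr ?mulr_gt0//.
have k2 : 2 * k <= expR (2 * k).
  by apply: le_trans (expR_ge1Dx _); rewrite lerDr.
apply: (@le_trans _ _ (expR (4 * Lam - c2 * Z) * expR (2 * k))).
  by rewrite ler_pM2l ?expR_gt0.
rewrite -expRD ler_expR; move: hZ; rewrite /delta /a; lra.
Qed.

Theorem theorem3 (R : realType) (nu : R) (nu_gt0 : 0 < nu) (nu_lt1 : nu < 1) :
  exists c_nu : R, 0 < c_nu /\
  forall (X : choiceType)
    (dV : measure_display) (V : measurableType dV)
    (K : X -> V -> V -> R)
    (dPi : measure_display) (Pi : measurableType dPi)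
    (law : Pi -> probability V R)
    (mu : probability Pi R) (pistar : Pi)
    (dO : measure_display) (Omega : measurableType dO)
    (P : probability Omega R)
    (Xs : int -> Omega -> X) (Vs : int -> Omega -> V),
  emission_kernel K ->
  (forall p q : Pi,
     (forall A, measurable A -> law p A = law q A) -> p = q) ->
  (forall (n : nat) (x : n.-tuple X),
     measurable_fun setT (fun p : Pi => expR (loglik K (law p) x))) ->
  process_law K (law pistar) P Xs Vs ->
  (forall x v w, nu <= K x v w) ->
  forall (c1 c2 : R), 0 < c1 -> 0 < c2 -> c_nu + c1 < c2 ->
  forall (Pin : nat -> set Pi) (eps epst : nat -> R),
  (forall n, (0 < n)%N -> measurable (Pin n)) ->
  (forall n, (0 < n)%N -> 0 < eps n) ->
  (forall n, (0 < n)%N -> 0 < epst n) ->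
  (fun n => ((n%:R * epst n ^+ 2)^-1 * ln (epst n) ^+ 2)%R : R^o)
    =o_\oo (fun=> 1%R : R^o) ->
  (forall n, (0 < n)%N -> epst n <= eps n) ->
  (forall n, (0 < n)%N ->
     (lne (covering_number (law @` Pin n) (eps n))
        <= (n%:R * eps n ^+ 2)%:E)%E) ->
  (forall n, (0 < n)%N ->
     measurable [set p : Pi | tv_dist (law p) (law pistar) <= epst n]) ->
  (forall n, (0 < n)%N ->
     ((expR (- c1 * n%:R * epst n ^+ 2))%:E
        <= mu [set p : Pi | (tv_dist (law p) (law pistar) <= epst n)%R])%E) ->
  (forall n, (0 < n)%N ->
     (mu (~` Pin n) <= (expR (- c2 * n%:R * epst n ^+ 2))%:E)%E) ->
  forall (alpha : nat -> R) (c_alpha c_bar : R),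
  (forall n, (0 < n)%N -> 0 < alpha n) ->
  0 < c_alpha -> c_alpha < c2 - c_nu - c1 ->
  (fun n => ((alpha n)^-1)%R : R^o)
    =O_\oo (fun n => expR (c_alpha * n%:R * epst n ^+ 2)%R : R^o) ->
  2 * (1 + Num.sqrt 2) * (1 + Num.sqrt c2) * c_nu < c_bar ->
  P [set w | alpha n <
       posterior K law mu (observations Xs n w)
         [set p : Pi | c_bar * eps n < risk K P Xs (law pistar) (law p)]]
    @[n --> \oo] --> 0%E.
Proof.
have nuW := ltW nu_lt1.
set Cp := predictive_const nu; set Lam := - ln nu.
have Cp0 : 0 <= Cp by exact: predictive_const_ge0.
have L0 : 0 < Lam by rewrite oppr_gt0 ln_lt0// nu_gt0.
(* Chi-square exponent, two Lipschitz transfers, deviation at the centres, and a slack of 2, one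
   unit of which is the extra [Z] in the evidence exponent. *)
exists (Cp ^+ 2 + 2 * Cp + 32 * Lam + 2); split.
  by have := sqr_ge0 Cp; move: Cp0 L0; lra.
move=> X dV V K dPi Pi law mu pistar dO Omega P Xs Vs hK _ mlik XV Knu
  c1 c2 c10 c20 c12 Pin eps epst mPin eps0 epst0 ho epse hcov mball hball hsieve
  alpha ca cbar al0 ca0 hca hO hcbar.
have [v0 _] := probability_inhabited (law pistar).
have [E [uE memE sumK]] := emission_alphabet v0 hK nu_gt0 Knu.
have K_bounds x v w : nu <= K x v w <= 1.
  by rewrite Knu; have /andP[] := emission_range hK x v w.
have K_measurable := emission_measurable hK.
have lik_measurable u : measurable_fun setT (fun p : Pi => lik K (law p) u).
  have := mlik (size u) (in_tuple u).
  by under eq_fun do rewrite (expR_loglik nu_gt0 K_bounds K_measurable).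
have [L LE hL] : exists2 L : probability V R -> R,
    forall q, limit_loglik K P Xs q = L q &
    forall q n, `|mean_loglik K (law pistar) E q n - n%:R * L q| <= 2 * Lam.
  exists (limit_loglik K P Xs) => // q n.
  exact: (limit_loglik_mean nu_gt0 nuW K_bounds K_measurable XV uE memE sumK).
pose A n := [set p : Pi | cbar * eps n < risk K P Xs (law pistar) (law p)].
have mA n : measurable (A n).
  have mL := measurable_mean_limit nu_gt0 nu_lt1 K_bounds K_measurable
    lik_measurable hL.
  have mf : measurable_fun setT (fun p : Pi => L (law pistar) - L (law p)).
    exact: (measurable_funB (measurable_cst (L (law pistar))) mL).
  have -> : A n = (fun p => L (law pistar) - L (law p)) @^-1` `]cbar * eps n, +oo[.
    by apply/seteqP; split => p; rewrite /A /risk /= !LE in_itv /= andbT.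
  by rewrite -[X in measurable X]setTI; exact: mf.
pose S n := \sum_(u <- words E n |
  alpha n < joint K law mu (A n) u / evidence K law mu u) lik K (law pistar) u.
have PE : (fun n => P [set w | alpha n <
    posterior K law mu (observations Xs n w) (A n)]) = (fun n => (S n)%:E).
  apply/funext => n.
  rewrite -(prob_obs_event nu_gt0 K_bounds K_measurable XV uE memE n
    (fun u => alpha n < joint K law mu (A n) u / evidence K law mu u)).
  have postE w : posterior K law mu (observations Xs n w) (A n) =
      joint K law mu (A n) (observations Xs n w)
        / evidence K law mu (observations Xs n w).
    rewrite /posterior; congr (_ / _); apply: eq_Rintegral => p _;
      by rewrite (expR_loglik nu_gt0 K_bounds K_measurable).
  by congr (P _); apply/seteqP; split => w /=; rewrite postE.
rewrite -/A PE.
have lik_pos q u : 0 < lik K q u := lik_gt0 nu_gt0 K_bounds K_measurable q u.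
have S0 n : 0 <= S n by apply: sumr_ge0 => u _; exact: ltW.
have [k [hk k0]] : exists k : R, (\forall n \near \oo,
    `|(alpha n)^-1| <= k * `|expR (ca * n%:R * epst n ^+ 2)|) /\ 0 < k.
  move/eqOP : hO => h.
  have [k [h1 h2]] := filter_ex (filterI h (nbhs_pinfty_gt (num_real (0 : R)))).
  by exists k.
pose Z n := n%:R * epst n ^+ 2.
have hZ := nepst2_cvg epst0 ho.
pose delta := c2 - ca - c1 - (Cp ^+ 2 + 1).
have delta0 : 0 < delta.
  by rewrite /delta; move: Cp0 L0 hca; lra.
(* Evidence, sieve and cover contribute the coefficients 1, [2 * k] and 2. *)
have main : \forall n \near \oo,
    S n <= (3 + 2 * k) * expR (- (Num.min 1 delta * Z n)).
  near=> n.
  have n0 : (0 < n)%N by near: n; exact: nbhs_infty_gt.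
  have Zn0 : 0 <= Z n by rewrite mulr_ge0 ?sqr_ge0.
  have e1 : expR (- Z n) <= expR (- (Num.min 1 delta * Z n)).
    by rewrite ler_expR lerN2 -[leRHS]mul1r ler_wpM2r// ge_min lexx.
  have e2 : expR (- (delta * Z n)) <= expR (- (Num.min 1 delta * Z n)).
    by rewrite ler_expR lerN2 ler_wpM2r// ge_min lexx orbT.
  (* With no parameter of large risk the posterior mass is 0, below [alpha n]. Otherwise [p0] bounds
     [cbar * eps n] by the maximal risk. *)
  have [[p0 Ap0]|noA] := pselect (exists p, A n p); last first.
    have -> : S n = 0.
      apply: big1_seq => u /andP[+ _]; rewrite /joint.
      have -> : A n = set0.
        by apply/seteqP; split => // p Ap; exfalso; apply: noA; exists p.
      under eq_Rintegral do rewrite indicE in_set0 mul0r.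
      by rewrite prob_Rintegral_cst mul0r ltNge (ltW (al0 n n0)).
    by rewrite mulr_ge0 ?expR_ge0// addr_ge0// mulr_ge0// ltW.
  have ce : cbar * eps n <= 5 * Lam.
    have /andP[b1 b2] := mean_limit_bounds nu_gt0 K_bounds K_measurable sumK
      (law pistar) hL.
    have /andP[b3 b4] := mean_limit_bounds nu_gt0 K_bounds K_measurable sumK
      (law p0) hL.
    by move: Ap0; rewrite /A /= /risk !LE /Lam => ?; lra.
  have alk : (alpha n)^-1 <= k * expR (ca * Z n).
    have : `|(alpha n)^-1| <= k * `|expR (ca * n%:R * epst n ^+ 2)|.
      by near: n.
    rewrite !ger0_norm ?expR_ge0 ?invr_ge0 ?(ltW (al0 n n0))//.
    by rewrite /Z mulrA.
  have dZ : 4 * Lam + 2 * k <= delta * Z n.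
    rewrite -ler_pdivrMl// /Z.
    by near: n; exact: hZ.
  have [en2 hM] := exponential_bookkeeping Cp0 L0 c20 k0 (ler0n R n) (eps0 n n0)
    (epst0 n n0) (epse n n0) (erefl (Z n)) (al0 n n0) hcbar ce alk dZ.
  have Arisk p : A n p -> cbar * eps n < L (law pistar) - L (law p).
    by rewrite /A /risk /= !LE.
  have [m [c [mb hc]]] := covering_number_cover (hcov n n0).
  have hc' p : Pin n p -> exists i, tv_dist (law p) (c i) <= eps n.
    by move=> Pp; apply: hc; exists p.
  have ball : expR (- c1 * n%:R * epst n ^+ 2) <=
      fine (mu [set p | tv_dist (law p) (law pistar) <= epst n]).
    rewrite -lee_fin fineK ?fin_num_measure//; last exact: mball.
    exact: hball.
  have sieve : fine (mu (~` Pin n)) <= expR (- c2 * n%:R * epst n ^+ 2).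
    rewrite -lee_fin fineK ?fin_num_measure//; last exact/measurableC/mPin.
    exact: hsieve.
  apply: (le_trans (posterior_sum_bound nu_gt0 nu_lt1 K_bounds K_measurable sumK
    lik_measurable (fun q => hL q n) (mA n) (mPin n n0) (al0 n n0) hc'
    Arisk hM (ltW (eps0 n n0)) en2 (mball n n0) (expR_gt0 _) ball)).
  rewrite -/Cp -/Lam.
  set a := (c1 + Cp ^+ 2 + 1) * Z n.
  have t1 : expR (- a) * ((expR (- c1 * n%:R * epst n ^+ 2))^-1 *
      expR (n%:R * (Cp * epst n) ^+ 2)) = expR (- Z n).
    by rewrite -expRN -!expRD; congr expR; rewrite /a /Z; ring.
  have t2 : (alpha n * expR (- a) / 2)^-1 * fine (mu (~` Pin n)) <=
      2 * k * expR (- (delta * Z n)).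
    have -> : (alpha n * expR (- a) / 2)^-1 = (alpha n)^-1 * (2 * expR a).
      by rewrite expRN; field; rewrite !gt_eqF ?expR_gt0// al0.
    apply: (@le_trans _ _ (k * expR (ca * Z n) * (2 * expR a) *
        expR (- c2 * n%:R * epst n ^+ 2))).
      apply: ler_pM => //.
      - by rewrite !mulr_ge0 ?invr_ge0 ?expR_ge0// ltW// al0.
      - exact/fine_ge0/measure_ge0.
      - by rewrite ler_wpM2r// mulr_ge0// expR_ge0.
    rewrite le_eqVlt; apply/orP; left; apply/eqP.
    transitivity (2 * k * (expR (ca * Z n) * expR a *
      expR (- c2 * n%:R * epst n ^+ 2))); first by ring.
    by rewrite -!expRD; congr (_ * expR _); rewrite /a /delta /Z; ring.
  (* The entropy uses up half of the deviation exponent, and the other half dominates [Z n] because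
     [epst n <= eps n]. *)
  have t3 : m%:R * expR (- (2 * n%:R * eps n ^+ 2)) <= 2 * expR (- Z n).
    apply: (@le_trans _ _ (2 * expR (n%:R * eps n ^+ 2) *
        expR (- (2 * n%:R * eps n ^+ 2)))).
      by rewrite ler_wpM2r// expR_ge0.
    rewrite -mulrA ler_pM2l// -expRD ler_expR.
    have : Z n <= n%:R * eps n ^+ 2.
      rewrite ler_wpM2l//; apply: lerXn2r; last exact: epse.
      - by rewrite nnegrE ltW// epst0.
      - by rewrite nnegrE ltW// eps0.
    lra.
  rewrite t1.
  have e2k : k * expR (- (delta * Z n)) <= k * expR (- (Num.min 1 delta * Z n)).
    by rewrite ler_pM2l.
  lra.
have kap0 : 0 < Num.min 1 delta by rewrite lt_min ltr01.
have k3 : 0 < 3 + 2 * k by move: k0; lra.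
apply: cvg_EFin; first exact: nearW.
apply/cvgrPdist_le => /= e e0; near=> n.
rewrite sub0r normrN ger0_norm//.
have Sn : S n <= (3 + 2 * k) * expR (- (Num.min 1 delta * Z n)) by near: n.
apply: (le_trans Sn); rewrite expRN ler_pdivrMr ?expR_gt0//.
rewrite -ler_pdivrMl//; apply: le_trans (expR_ge1Dx _).
apply: (@le_trans _ _ (Num.min 1 delta * Z n)); last by rewrite lerDr.
by rewrite -ler_pdivrMl// /Z; near: n; exact: hZ.
Unshelve. all: by end_near. Qed.
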